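(* Let $K$ be an algebraically closed field, $Q$ a quiver and $\boldsymbol{\underline d}=(\underline d^0,\dots,\underline d^\nu)$ a filtration. Assume that there is an $M\in\mathcal{A}_{\boldsymbol{\underline d}}(K)$ such that $\dim_K\mathrm{Ext}^1_Q(M,M)=\operatorname{codim}\mathcal{A}_{\boldsymbol{\underline d}}(K)$. Then the quiver flag variety $\mathrm{Fl}_Q\binom{M}{\boldsymbol{\underline d}}$ is smooth and irreducible.
   Context: $Q$ is a finite quiver. A filtration is a sequence $\boldsymbol{\underline d}=(\underline d^0,\dots,\underline d^\nu)$ of dimension vectors with $\underline d^0=0$ and $\underline d^i\le\underline d^{i+1}$ (componentwise) for all $i$. $\mathrm{Rep}_Q(\underline d)=\bigoplus_{\alpha:i\to j}\mathrm{Hom}_K(K^{d_i},K^{d_j})$ is the representation space. For a representation $M$ with dimension vector $\underline d^\nu$, $\mathrm{Fl}_Q\binom{M}{\boldsymbol{\underline d}}$ is the projective $K$-scheme (closed subscheme of the product over the vertices of the usual partial flag varieties) whose $R$-points, for a $K$-algebra $R$, are the sequences $U^0\subset U^1\subset\dots\subset U^\nu=M\otimes_KR$ of subrepresentations of $M\otimes_KR$ such that each $U^k_i$ ($i\in Q_0$) is a direct summand of $M_i\otimes R$ of rank $d^k_i$. $\mathcal{A}_{\boldsymbol{\underline d}}(K)\subseteq\mathrm{Rep}_Q(\underline d^\nu)$ is the closed irreducible $\mathrm{GL}_{\underline d^\nu}$-stable subvariety of all representations $M$ such that $\mathrm{Fl}_Q\binom{M}{\boldsymbol{\underline d}}$ is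 non-empty; its codimension is taken in $\mathrm{Rep}_Q(\underline d^\nu)$. $\mathrm{Ext}^1_Q$ is $\mathrm{Ext}^1$ over the path algebra $KQ$. *)

(* Defs.v *)
From HB Require Import structures.
From mathcomp Require Import all_boot all_order all_algebra.
From mathcomp Require Import boolp classical_sets.
From mathcomp Require Import mpoly.

Set Implicit Arguments.
Unset Strict Implicit.
Unset Printing Implicit Defensive.

Import GRing.Theory.
Local Open Scope classical_set_scope.
Local Open Scope ring_scope.

(* A [K]-scheme is given by its functor of points on commutative [K]-algebras.
   A [comAlgType] is never the zero ring; nothing is lost, since a scheme has
   exactly one point over the zero ring. *)
Record kfunctor (K : closedFieldType) := KFunctor {
  points :> comAlgType K -> Type;
  pmap : forall R S : comAlgType K, {lrmorphism R -> S} -> points R -> points S;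
  pmap_id : forall (R : comAlgType K) (x : points R), pmap idfun x = x;
  pmap_comp : forall (R S T : comAlgType K)
      (f : {lrmorphism R -> S}) (g : {lrmorphism S -> T}) (x : points R),
    pmap (g \o f) x = pmap g (pmap f x)
}.

Section FunctorGeometry.
Variables (K : closedFieldType) (X : kfunctor K).

Definition subfunctor := forall R : comAlgType K, set (X R).

(* [U] is open when, for every [x : Spec R -> X], the preimage of [U] is the
   complement of the closed subscheme defined by (the ideal generated by) some
   [J]: a morphism [Spec S -> Spec R] factors through it iff [J] generates the
   unit ideal of [S].  Taking [S = R], this forces stability under base
   change.  Open subfunctors of a scheme are its open subschemes, i.e. the open
   subsets of its underlying topological space. *)
Definition open_subfunctor (U : subfunctor) : Prop :=
  forall (R : comAlgType K) (x : X R), exists J : set R,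
  forall (S : comAlgType K) (f : {lrmorphism R -> S}),
    U S (pmap f x) <->
    exists (m : nat) (a : 'I_m -> R) (s : 'I_m -> S),
      (forall j, J (a j)) /\ \sum_(j < m) s j * f (a j) = 1.

Definition nonempty_subfunctor (U : subfunctor) : Prop :=
  exists (R : comAlgType K) (x : X R), U R x.

Definition nonempty_functor : Prop := nonempty_subfunctor (fun R => setT).

(* Irreducibility of the underlying topological space. *)
Definition irreducible : Prop :=
  nonempty_functor /\
  forall U V : subfunctor, open_subfunctor U -> open_subfunctor V ->
    nonempty_subfunctor U -> nonempty_subfunctor V ->
    nonempty_subfunctor (fun R => U R `&` V R).

(* Lifting along square-zero extensions of affine [K]-schemes; this is
   smoothness over [K] for schemes locally of finite type over [K]. *)
Definition smooth : Prop :=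
  forall (R S : comAlgType K) (f : {lrmorphism R -> S}),
    (forall s, exists r, f r = s) ->
    (forall a b, f a = 0 -> f b = 0 -> a * b = 0) ->
    forall y : X S, exists x : X R, pmap f x = y.

End FunctorGeometry.

Record quiver := Quiver {
  vert : finType;
  arr : finType;
  src : arr -> vert;
  tgt : arr -> vert
}.

Definition dimvec (Q : quiver) := vert Q -> nat.

Record filtration (Q : quiver) (nu : nat) := Filtration {
  fdim :> 'I_nu.+1 -> dimvec Q;
  fdim0 : forall i, fdim ord0 i = 0%N;
  fdim_le : forall k l : 'I_nu.+1, l = k.+1 :> nat ->
    forall i, (fdim k i <= fdim l i)%N
}.

(* [K^n] consists of row vectors, on which matrices act on the right. *)
Definition repspace (K : closedFieldType) (Q : quiver) (e : dimvec Q) :=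
  forall a : arr Q, 'M[K]_(e (src a), e (tgt a)).

Section Submodules.
Variables (R : comNzRingType) (n : nat).
Implicit Types U W : set 'rV[R]_n.

Definition submodule U : Prop :=
  U 0 /\ forall (a : R) u v, U u -> U v -> U (a *: u + v).

Definition direct_summand U : Prop :=
  submodule U /\ exists W, [/\ submodule W,
    forall v, exists u w, [/\ U u, W w & v = u + w]
    & forall v, U v -> W v -> v = 0].

End Submodules.

(* The [S]-span of the image of [U]; when [U] is a direct summand of [R^n] this
   is the image of the injection of [S ⊗_R U] into [S^n]. *)
Definition base_change (R S : comNzRingType) (f : {rmorphism R -> S}) (n : nat)
    (U : set 'rV[R]_n) : set 'rV[S]_n :=
  [set v | exists (m : nat) (a : 'rV[S]_m) (B : 'M[R]_(m, n)),
     (forall i, U (row i B)) /\ v = a *m map_mx f B].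

(* Constant rank [r]: the fibre at every point of [Spec R] has dimension [r].
   Only used for direct summands. *)
Definition has_rank (R : comNzRingType) (n : nat) (U : set 'rV[R]_n) (r : nat) :
    Prop :=
  forall (L : fieldType) (f : {rmorphism R -> L}),
  exists B : 'M[L]_(r, n),
    row_free B /\ forall v, base_change f U v <-> (v <= B)%MS.

Section Flags.
Variables (K : closedFieldType) (Q : quiver) (nu : nat) (d : filtration Q nu).
Variable M : repspace K (d ord_max).

Record is_flag (R : comAlgType K)
    (U : forall (k : 'I_nu.+1) (i : vert Q), set 'rV[R]_(d ord_max i)) : Prop :=
  IsFlag {
    flag_summand : forall k i, direct_summand (U k i);
    flag_rank : forall k i, has_rank (U k i) (d k i);
    flag_arr : forall k a v,
      U k (src a) v -> U k (tgt a) (v *m map_mx (in_alg R) (M a));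
    flag_sub : forall k l : 'I_nu.+1, l = k.+1 :> nat ->
      forall i, U k i `<=` U l i;
    flag_max : forall i, U ord_max i = setT
  }.

Definition flag (R : comAlgType K) := {U | @is_flag R U}.

End Flags.

Lemma base_change_id (R : comNzRingType) (n : nat) (U : set 'rV[R]_n) :
  submodule U -> base_change idfun U = U.
Proof.
move=> [U0 UD]; apply/seteqP; split => v /=.
  move=> [m [a [B [HB ->]]]]; rewrite map_mx_id // mulmx_sum_row.
  elim/big_ind: _ => // [x y Ux Uy|i _].
    by rewrite -[x]scale1r; apply: UD.
  by rewrite -[_ *: _]addr0; apply: UD.
move=> Uv; exists 1%N, 1%:M, v; split; last by rewrite map_mx_id // mul1mx.
by move=> i; rewrite row_id.
Qed.

Lemma base_change_comp (R S T : comNzRingType) (f : {rmorphism R -> S})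
    (g : {rmorphism S -> T}) (n : nat) (U : set 'rV[R]_n) :
  base_change (g \o f) U = base_change g (base_change f U).
Proof.
apply/seteqP; split => v /=.
  move=> [m [a [B [HB ->]]]]; exists m, a, (map_mx f B); split.
    move=> i; exists 1%N, 1%:M, (row i B); split; last by rewrite map_row mul1mx.
    by move=> j; rewrite row_id.
  by rewrite -map_mx_comp.
move=> [m [a [B [HB ->]]]].
rewrite mulmx_sum_row; elim/big_ind: _ => [|x y|i _].
- exists 0%N, 0, 0; split; last by rewrite mul0mx.
  by case.
- move=> [p [b [C [HC ->]]]] [q [c [D [HD ->]]]].
  exists (p + q)%N, (row_mx b c), (col_mx C D); split.
    by move=> j; case: (splitP j) => k jk;
      [rewrite (_ : j = lshift q k) ?row_Ku ?rowKu //; exact: val_inj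
      |rewrite (_ : j = rshift p k) ?rowKd //; exact: val_inj].
  by rewrite map_col_mx mul_row_col.
rewrite -map_row; have [p [b [C [HC eqv]]]] := HB i.
exists p, (a 0 i *: map_mx g b), C; split=> //.
by rewrite eqv map_mxM -map_mx_comp scalemxAl.
Qed.

Lemma direct_summandP (R : comNzRingType) (n : nat) (U : set 'rV[R]_n) :
  direct_summand U <->
  exists e : 'M[R]_n, e *m e = e /\ forall v, U v <-> v *m e = v.
Proof.
split.
  move=> [[U0 UD] [W [[W0 WD] Hsum Hcap]]].
  have Usum m (a : 'rV_m) (B : 'M_(m, n)) : (forall i, U (row i B)) -> U (a *m B).
    move=> HB; rewrite mulmx_sum_row; elim/big_ind: _ => // [x y Ux Uy|i _].
      by rewrite -[x]scale1r; apply: UD.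
    by rewrite -[_ *: _]addr0; apply: UD.
  have Wsum m (a : 'rV_m) (B : 'M_(m, n)) : (forall i, W (row i B)) -> W (a *m B).
    move=> HB; rewrite mulmx_sum_row; elim/big_ind: _ => // [x y Wx Wy|i _].
      by rewrite -[x]scale1r; apply: WD.
    by rewrite -[_ *: _]addr0; apply: WD.
  have dec (j : 'I_n) : exists u, U u /\ W (row j 1%:M - u).
    have [u [w [Uu Ww ->]]] := Hsum (row j 1%:M).
    by exists u; split=> //; rewrite [u + w]addrC addrK.
  have [E HE] := choice dec.
  pose e : 'M[R]_n := \matrix_j E j.
  have Ue v : U (v *m e) by apply: Usum => i; rewrite rowK; case: (HE i).
  have We v : W (v - v *m e).
    rewrite -{1}[v]mulmx1 -mulmxBr; apply: Wsum => i.
    by rewrite linearB /= rowK; case: (HE i).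
  have fixU v : U v -> v *m e = v.
    move=> Uv; apply/eqP; rewrite eq_sym -subr_eq0; apply/eqP; apply: Hcap => //.
    by rewrite addrC -scaleN1r; apply: UD.
  exists e; split; last by move=> v; split=> [/fixU //|<-].
  apply/row_matrixP => i; rewrite row_mul fixU //.
  by rewrite rowK; case: (HE i).
move=> [e [ee HU]]; split.
  split; first by apply/HU; rewrite mul0mx.
  move=> a u v /HU uE /HU vE; apply/HU.
  by rewrite mulmxDl -scalemxAl uE vE.
exists [set v | v *m e = 0]; split.
- split; first by rewrite /= mul0mx.
  by move=> a u v /= uE vE; rewrite mulmxDl -scalemxAl uE vE scaler0 addr0.
- move=> v; exists (v *m e), (v - v *m e); split.
  + by apply/HU; rewrite -mulmxA ee.
  + by rewrite /= mulmxBl -mulmxA ee subrr.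
  + by rewrite addrC subrK.
- by move=> v /HU vE /= v0; rewrite -vE.
Qed.

Lemma base_change_summand (R S : comNzRingType) (f : {rmorphism R -> S})
    (n : nat) (U : set 'rV[R]_n) :
  direct_summand U -> direct_summand (base_change f U).
Proof.
move=> /direct_summandP [e [ee HU]]; apply/direct_summandP.
exists (map_mx f e); split; first by rewrite -map_mxM ee.
move=> v; split.
  move=> [m [a [B [HB ->]]]]; rewrite -mulmxA -map_mxM; congr (_ *m map_mx _ _).
  by apply/row_matrixP => i; rewrite row_mul; apply/HU.
move=> <-; exists n, v, e; split=> // i.
by apply/HU; rewrite -row_mul ee.
Qed.

Lemma base_change_rank (R S : comNzRingType) (f : {rmorphism R -> S})
    (n : nat) (U : set 'rV[R]_n) (r : nat) :
  has_rank U r -> has_rank (base_change f U) r.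
Proof. by move=> HU L g; rewrite -base_change_comp; apply: HU. Qed.

Section FlagFunctor.
Variables (K : closedFieldType) (Q : quiver) (nu : nat) (d : filtration Q nu).
Variable M : repspace K (d ord_max).

Lemma base_change_flag (R S : comAlgType K) (f : {lrmorphism R -> S})
    (U : forall (k : 'I_nu.+1) (i : vert Q), set 'rV[R]_(d ord_max i)) :
  is_flag M U -> is_flag M (fun k i => base_change f (U k i)).
Proof.
case=> Hs Hr Ha Hi Hm; split.
- by move=> k i; apply: base_change_summand.
- by move=> k i; apply: base_change_rank.
- move=> k a v [m [b [B [HB ->]]]].
  exists m, b, (B *m map_mx (in_alg R) (M a)); split.
    by move=> i; rewrite row_mul; apply: Ha.
  rewrite -mulmxA map_mxM -map_mx_comp; congr (_ *m (_ *m _)).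
  by apply/matrixP => i j; rewrite !mxE /= rmorph_alg.
- move=> k l kl i v [m [b [B [HB ->]]]]; exists m, b, B; split=> // j.
  exact: (Hi k l kl).
- move=> i; apply/seteqP; split=> // v _; exists _, v, 1%:M.
  by rewrite Hm map_mx1 mulmx1.
Qed.

Definition flag_map (R S : comAlgType K) (f : {lrmorphism R -> S})
    (U : flag M R) : flag M S :=
  exist _ _ (base_change_flag f (proj2_sig U)).

Lemma flag_eq (R : comAlgType K) (U V : flag M R) :
  (forall k i, proj1_sig U k i = proj1_sig V k i) -> U = V.
Proof.
case: U V => [U HU] [V HV] /= UV; apply: eq_exist.
by apply: functional_extensionality_dep => k;
  apply: functional_extensionality_dep => i.
Qed.

Lemma flag_map_id (R : comAlgType K) (U : flag M R) : flag_map idfun U = U.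
Proof.
apply: flag_eq => k i /=; apply: base_change_id.
by case: (flag_summand (proj2_sig U) k i).
Qed.

Lemma flag_map_comp (R S T : comAlgType K) (f : {lrmorphism R -> S})
    (g : {lrmorphism S -> T}) (U : flag M R) :
  flag_map (g \o f) U = flag_map g (flag_map f U).
Proof. by apply: flag_eq => k i /=; exact: base_change_comp. Qed.

Definition Fl : kfunctor K := KFunctor flag_map_id flag_map_comp.

End FlagFunctor.

Definition Avar (K : closedFieldType) (Q : quiver) (nu : nat)
    (d : filtration Q nu) : set (repspace K (d ord_max)) :=
  [set M | nonempty_functor (Fl M)].
Arguments Avar K {Q nu} d.

Section Zariski.
Variables (K : closedFieldType) (Q : quiver) (e : dimvec Q).
Local Notation V := (repspace K e).

Definition entry := {a : arr Q & ('I_(e (src a)) * 'I_(e (tgt a)))%type}.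

Definition coords (M : V) : 'I_#|{: entry}| -> K :=
  fun k => let x : entry := enum_val k in M (tag x) (tagged x).1 (tagged x).2.

Definition zariski_closed (Z : set V) : Prop :=
  exists I : set {mpoly K[#|{: entry}|]},
    Z = [set M | forall p, I p -> p.@[coords M] = 0].

Definition irreducible_closed (Z : set V) : Prop :=
  [/\ zariski_closed Z, Z !=set0
    & forall Z1 Z2 : set V, zariski_closed Z1 -> zariski_closed Z2 ->
        Z `<=` Z1 `|` Z2 -> Z `<=` Z1 \/ Z `<=` Z2].

Definition closed_chain (Z : set V) (c : nat) : Prop :=
  exists F : 'I_c.+1 -> set V,
    [/\ F ord0 = Z, forall k, irreducible_closed (F k)
      & forall k l : 'I_c.+1, l = k.+1 :> nat -> F k `<` F l].

(* Codimension in [V] of an irreducible closed subset: the supremum of the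
   lengths of the chains of irreducible closed subsets starting at it. *)
Definition codim_is (Z : set V) (c : nat) : Prop :=
  closed_chain Z c /\ forall c' : nat, closed_chain Z c' -> (c' <= c)%N.

End Zariski.

Section Ext.
Variables (K : closedFieldType) (Q : quiver).

(* Modules over the path algebra [KQ], i.e. representations of [Q] in [K]-vector
   spaces of arbitrary dimension: projective [KQ]-modules are infinite
   dimensional in general. *)
Record qrep := QRep {
  qspace : vert Q -> lmodType K;
  qmap : forall a : arr Q, {linear qspace (src a) -> qspace (tgt a)}
}.

Record qhom (X Y : qrep) := QHom {
  qhom_fun :> forall i : vert Q, {linear qspace X i -> qspace Y i};
  qhom_comm : forall (a : arr Q) (x : qspace X (src a)),
    qhom_fun (tgt a) (qmap X a x) = qmap Y a (qhom_fun (src a) x)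
}.

Definition qmono (X Y : qrep) (f : qhom X Y) : Prop :=
  forall i, injective (f i).

Definition qepi (X Y : qrep) (f : qhom X Y) : Prop :=
  forall i y, exists x, f i x = y.

Definition short_exact (X Y Z : qrep) (f : qhom X Y) (g : qhom Y Z) : Prop :=
  [/\ qmono f, qepi g & forall i y, g i y = 0 <-> exists x, f i x = y].

Definition projective (P : qrep) : Prop :=
  forall (X Y : qrep) (g : qhom X Y) (h : qhom P Y), qepi g ->
    exists h' : qhom P X, forall i p, g i (h' i p) = h i p.

(* [dim_K Ext^1(X, Y) = c].  For [0 -> W -> P -> X -> 0] exact with [P]
   projective, [Ext^1(X, Y)] is the cokernel of [Hom(P, Y) -> Hom(W, Y)]; the
   classes of [b_1, ..., b_c] are required to form a basis of it. *)
Definition dim_ext1_is (X Y : qrep) (c : nat) : Prop :=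
  exists (W P : qrep) (f : qhom W P) (g : qhom P X),
    [/\ projective P, short_exact f g
      & exists b : 'I_c -> qhom W Y,
          forall u : qhom W Y, exists! a : 'rV[K]_c,
          exists h : qhom P Y, forall i w,
            u i w = \sum_(j < c) a 0 j *: b j i w + h i (f i w)].

Definition rep_of (e : dimvec Q) (M : repspace K e) : qrep :=
  @QRep (fun i => 'rV[K]_(e i))
        (fun a => mulmxr (M a) : {linear 'rV[K]_(e (src a)) -> 'rV[K]_(e (tgt a))}).

End Ext.

(* Main.v *)
(* Let [r] be the rank of [phi |-> phi M - M phi], from the endomorphisms of the
   vertex spaces to the representation space. The cokernel of this map is
   [Ext^1(M, M)], so its dimension is the codimension [c] of [A_d].

   Density. On the orbit of [M] there are [r] algebraically independent functions.
   A polynomial vanishing on the orbit but not on [A_d] would be one more on [A_d],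
   and each of the [c] steps of a chain of irreducible closed sets above [A_d]
   yields another: together more than the dimension [r + c] of the representation
   space. So all [N] in [A_d] satisfy the equations of the orbit expressing that
   [phi |-> phi M - N phi] has rank at most [r]; these then hold over every
   [K]-algebra for representations [N] admitting a flag of subrepresentations.

   Smoothness. Lift a flag along a square-zero extension and write [M = N + eps]
   with [N] preserving the lift and [eps] in the kernel. Bordering an invertible
   [r x r] minor by the identity of [M] and by a linear form [l] that vanishes on
   the image of [phi |-> phi M - M phi], the minor is [l(eps)] up to a unit. Hence
   [eps = phi M - M phi] with [phi] in the kernel, and conjugating the lifted flag
   by [1 + phi] makes it stable under [M].

   Irreducibility. For [Y] preserving the coordinate flag, Cramer's rule gives all
   solutions [h] of [Y h = h M] at points where the rank is [r]. So the image of
   the coordinate flag under [h] is a family over an open subset of an affine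
   space, and every field-valued point of the flag variety occurs in it. *)

Require Import Defs.
From HB Require Import structures.
From mathcomp Require Import all_boot all_order all_algebra.
From mathcomp Require Import boolp classical_sets.
From mathcomp Require Import mpoly ring_quotient ring.

Set Implicit Arguments.
Unset Strict Implicit.
Unset Printing Implicit Defensive.

Import GRing.Theory.
Local Open Scope classical_set_scope.
Local Open Scope ring_scope.

(** * Zero test, residue fields, localization *)

Lemma coef_muni (R : comNzRingType) (n : nat) (p : {mpoly R[n.+1]})
    (m : 'X_{1..n.+1}) :
  ((muni p)`_(m ord_max))@_[multinom m (widen_ord (leqnSn n) i) | i < n] = p@_m.
Proof.
rewrite muniE coef_sum raddf_sum /= (eq_bigr (fun m2 => p@_m2 * (m2 == m)%:R)).
  by rewrite [in RHS](mpolyE p) raddf_sum /=; apply: eq_bigr => i _;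
     rewrite mcoeffZ mcoeffX.
move=> m2 _; rewrite !coefZ coefXn.
have [->|ne] := eqVneq m2 m.
  by rewrite eqxx mulr1 mcoeffZ mcoeffX eqxx.
case: eqP => [e|]; last by rewrite !mulr0 mcoeff0.
rewrite mulr1 mcoeffZ mcoeffX; case: eqP => // e2; case/eqP: ne.
apply/mnmP => i; case: (unliftP ord_max i) => [j ->|-> //].
move/mnmP/(_ j): e2; rewrite !mnmE => e2.
suff -> : lift ord_max j = widen_ord (leqnSn n) j by [].
by apply: val_inj; rewrite /= /bump leqNgt ltn_ord.
Qed.

Lemma meval_muni (R : comNzRingType) (n : nat) (p : {mpoly R[n.+1]})
    (v : 'I_n.+1 -> R) :
  p.@[v] =
  (map_poly (meval (fun i => v (widen_ord (leqnSn n) i))) (muni p)).[v ord_max].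
Proof.
rewrite muniE rmorph_sum /= horner_sum mevalE; apply: eq_bigr => m _.
rewrite map_polyZ /= mevalZ map_polyXn hornerZ hornerXn mevalX -mulrA.
by congr (_ * _); rewrite big_ord_recr; congr (_ * _); apply: eq_bigr => i _;
  rewrite mnmE.
Qed.

(** Induction on the number of variables: with the others fixed, [p] is a polynomial in the last
    variable vanishing everywhere, hence zero, because an algebraically closed field is infinite. *)
Lemma meval_eq0 (K : closedFieldType) (n : nat) (p : {mpoly K[n]}) :
  (forall v, p.@[v] = 0) -> p = 0.
Proof.
elim: n p => [|n IH] p p0.
  apply/mpolyP => m; rewrite mcoeff0.
  have /= := p0 (fun=> 0); rewrite (mpolyE p) raddf_sum /= => <-.
  rewrite raddf_sum; apply: eq_bigr => m2 _ /=.
  rewrite mcoeffZ mcoeffX mevalZ mevalX big_ord0.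
  by have -> : m2 == m by apply/eqP/mnmP; case.
suff mp0 : muni p = 0 by apply/mpolyP => m; rewrite -coef_muni mp0 coef0 !mcoeff0.
apply/polyP => j; rewrite coef0; apply: IH => v.
suff /polyP /(_ j) : map_poly (meval v) (muni p) = 0 by rewrite coef_map coef0.
apply/eqP; apply: contraT => /closed_nonrootP [x /eqP]; case.
pose w (i : 'I_n.+1) := if unlift ord_max i is Some j then v j else x.
rewrite -[RHS](p0 w) meval_muni /w unlift_none; congr (_.[x]).
apply: eq_map_poly => q; apply: meval_eq => i.
suff -> : widen_ord (leqnSn n) i = lift ord_max i by rewrite liftK.
by apply: val_inj; rewrite /= /bump leqNgt ltn_ord.
Qed.

(** Maximality of [m] enters as invertibility modulo [m] of every element outside it. *)
Lemma residue_field_maximal (R : comNzRingType) (m : set R) :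
    m 0 -> (forall x y, m x -> m y -> m (x - y)) ->
    (forall a x, m x -> m (a * x)) -> ~ m 1 ->
    (forall x, ~ m x -> exists y, m (1 - y * x)) ->
  exists (L : fieldType) (f : {rmorphism R -> L}),
    (forall y, exists x, f x = y) /\ (forall x, m x -> f x = 0).
Proof.
move=> m0 mB mM m1 m_inv; pose I : R -> bool := fun x => `[< m x >].
have I_ideal : idealr_closed I.
  split; rewrite ?unfold_in; [exact/asboolP|exact/asboolP|].
  move=> a x y; rewrite !unfold_in => /asboolP mx /asboolP my; apply/asboolP.
  rewrite -[y]opprK -[- y]sub0r; apply: (mB); [exact: mM|exact: mB].
pose IaM := GRing.isZmodClosed.Build _ I (idealr_closedB I_ideal).
pose IpM := isProperIdeal.Build _ I (idealr_closed_nontrivial I_ideal).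
pose Iid : idealr _ := HB.pack I IaM IpM.
pose E : comNzRingType := {ideal_quot Iid}.
pose f : {rmorphism R -> E} := \pi_E%qT.
have f0 x : f x = 0 <-> m x.
  have E0 : (\pi_E x == \pi_E 0)%qT = `[< m (x - 0) >].
    by rewrite -[RHS]/(Iid (x - 0)) -Quotient.idealrBE.
  rewrite -(rmorph0 f); split => [/eqP|mx].
    by rewrite [_ == _]E0 subr0 => /asboolP.
  by apply/eqP; rewrite [_ == _]E0 subr0; apply/asboolP.
have fs (y : E) : exists x, f x = y by exists (repr y); rewrite /f /= reprK.
have /choice [inv invP] (x : E) :
    exists y, (x != 0 -> y * x = 1) /\ (x = 0 -> y = 0).
  have [->|xn0] := eqVneq x 0; first by exists 0.
  have [a fa] := fs x; have [y my] : exists y, m (1 - y * a).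
    by apply: m_inv => /f0; rewrite fa; apply/eqP.
  exists (f y); split=> [_|]; last by move/eqP: xn0.
  rewrite -fa -rmorphM -(rmorph1 f).
  by apply/eqP; rewrite eq_sym -subr_eq0 -rmorphB; apply/eqP/f0.
pose EF := GRing.ComNzRing_isField.Build E (fun x => (invP x).1) ((invP 0).2 erefl).
pose L : fieldType := HB.pack E EF.
by exists L, f; split=> // x /f0.
Qed.

Lemma residue_field (R : comNzRingType) (I : set R) :
    I 0 -> (forall x y, I x -> I y -> I (x - y)) ->
    (forall a x, I x -> I (a * x)) -> ~ I 1 ->
  exists (L : fieldType) (f : {rmorphism R -> L}),
    (forall y, exists x, f x = y) /\ (forall x, I x -> f x = 0).
Proof.
move=> I0 IB IM I1.
pose ideal (J : set R) := [/\ J 0, forall x y, J x -> J y -> J (x - y),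
  forall a x, J x -> J (a * x) & ~ J 1].
(* The condition bears on [J] together with [I], so that it also holds for the union of the empty
   chain in Zorn's lemma. *)
pose P (J : set R) := ideal (J `|` I).
have [J [[J0 JB JM J1] Jmax]] : exists A, P A /\ forall B, A `<` B -> ~ P B.
  apply: Zorn_bigcup => F FP Ftot; split.
  - by right.
  - have key x y : (\bigcup_(X in F) X `|` I) x -> (\bigcup_(X in F) X `|` I) y ->
       I x /\ I y \/ exists X, [/\ F X, (X `|` I) x & (X `|` I) y].
      case=> [[X FX Xx]|Ix] [[Y FY Yy]|Iy].
      + by right; case: (Ftot X Y FX FY) => XY; [exists Y|exists X];
        split=> //; left=> //; apply: XY.
      + by right; exists X; split=> //; [left|right].
      + by right; exists Y; split=> //; [right|left].
      + by left.
    move=> x y Hx Hy; case: (key x y Hx Hy) => [[Ix Iy]|[X [FX Xx Xy]]].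
      by right; apply: IB.
    by have [_ XB _ _] := FP X FX; case: (XB x y Xx Xy) => ?; [left; exists X|right].
  - move=> a x [[X FX Xx]|Ix]; last by right; apply: IM.
    by have [_ _ XM _] := FP X FX; case: (XM a x (or_introl Xx)) => ?;
      [left; exists X|right].
  - case=> // -[X FX X1]; have [_ _ _ nX1] := FP X FX; apply: nX1; by left.
set m := J `|` I in J0 JB JM J1.
have [|L [f [fs f0]]] := residue_field_maximal J0 JB JM J1.
  move=> x mx; apply: contrapT => nex.
  (* If [x] had no inverse modulo [m], the ideal generated by [m] and [x] would be proper and
     strictly larger. *)
  pose B : set R := [set z | exists a b, m b /\ z = a * x + b].
  have mB z : m z -> B z by move=> mz; exists 0, z; rewrite mul0r add0r.
  apply: (Jmax B).
    split; first by move=> z Jz; apply: mB; left.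
    move=> BJ; apply: mx; left; apply: BJ; exists 1, 0; rewrite mul1r addr0.
    by split.
  rewrite /P; have -> : B `|` I = B.
    by apply/seteqP; split=> z; [case=> // Iz; apply: mB; right|left].
  split; first exact: mB.
  - move=> u v [a [b [mb ->]]] [a' [b' [mb' ->]]]; exists (a - a'), (b - b').
    by split; [exact: JB|rewrite mulrBl opprD addrACA].
  - move=> c u [a [b [mb ->]]]; exists (c * a), (c * b).
    by split; [exact: JM|rewrite mulrDr mulrA].
  - move=> [a [b [mb e]]]; apply: nex; exists a; rewrite e.
    by rewrite addrC addKr.
by exists L, f; split=> // x Ix; apply: f0; right.
Qed.

(** An alias of [R], so that a ring or field known only with a ring map from [K] can serve as a test
    algebra of a functor. *)
Definition alg_via (K R : comNzRingType) (g : {rmorphism K -> R}) : Type := R.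

Section AlgVia.
Variables (K R : comNzRingType) (g : {rmorphism K -> R}).
Local Notation A := (alg_via g).

HB.instance Definition _ := GRing.ComNzRing.on A.

Let scale (a : K) (x : A) : A := g a * x.

Fact alg_via_scalerA a b v : scale a (scale b v) = scale (a * b) v.
Proof. by rewrite /scale rmorphM mulrA. Qed.

Fact alg_via_scale1r : left_id 1 scale.
Proof. by move=> x; rewrite /scale rmorph1 mul1r. Qed.

Fact alg_via_scalerDr : right_distributive scale +%R.
Proof. by move=> a x y; rewrite /scale mulrDr. Qed.

Fact alg_via_scalerDl v : {morph scale^~ v : a b / a + b}.
Proof. by move=> a b; rewrite /scale rmorphD mulrDl. Qed.

HB.instance Definition _ := GRing.Zmodule_isLmodule.Build K A
  alg_via_scalerA alg_via_scale1r alg_via_scalerDr alg_via_scalerDl.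

Fact alg_via_scalerAl a (u v : A) : a *: (u * v) = (a *: u) * v.
Proof. exact: mulrA. Qed.

HB.instance Definition _ := GRing.Lmodule_isLalgebra.Build K A alg_via_scalerAl.
HB.instance Definition _ := GRing.Lalgebra_isComAlgebra.Build K A.

Lemma in_alg_via a : in_alg A a = g a.
Proof. exact: mulr1. Qed.

End AlgVia.

Lemma rmorphism_of (R S : nzRingType) (f : R -> S) :
    (forall x y, f (x + y) = f x + f y) -> (forall x y, f (x * y) = f x * f y) ->
    f 1 = 1 -> exists g : {rmorphism R -> S}, g =1 f.
Proof.
move=> fD fM f1; have f0 : f 0 = 0.
  by apply: (addIr (f 0)); rewrite add0r -fD addr0.
have fB : zmod_morphism f.
  move=> x y; apply: (addIr (f y)); rewrite -fD !subrK.
  by [].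
pose zM := GRing.isZmodMorphism.Build R S f fB.
pose mM := GRing.isMonoidMorphism.Build R S f (conj f1 fM).
by exists (HB.pack_for {rmorphism R -> S} f zM mM).
Qed.

Lemma lrmorphism_of (K : comNzRingType) (R S : comAlgType K) (f : {rmorphism R -> S}) :
    (forall a, f (in_alg R a) = in_alg S a) -> exists g : {lrmorphism R -> S}, g =1 f.
Proof.
move=> fa; have fZ : scalable f.
  by move=> a x; rewrite -[a *: x]mulr_algl rmorphM fa mulr_algl.
pose sM := GRing.isScalable.Build K R S *:%R f fZ.
by exists (HB.pack_for {lrmorphism R -> S} (f : R -> S) f sM).
Qed.

Section Localization.
Variables (A : idomainType) (D : A).
Hypothesis Dn0 : D != 0.
Local Notation F := {fraction A}.
Local Notation "x %:F" := (@tofrac A x).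

(** The localization [A[1/D]], realized inside the fraction field so that it comes with its
    embedding there. *)
Definition loc_pred : {pred F} := fun x => `[< exists k a, x * (D ^+ k)%:F = a%:F >].

Fact loc_pred_subring : subring_closed loc_pred.
Proof.
split.
- by apply/asboolP; exists 0%N, 1; rewrite mul1r.
- move=> x y /asboolP [k [a ea]] /asboolP [l [b eb]]; apply/asboolP.
  exists (k + l)%N, (a * D ^+ l - b * D ^+ k).
  rewrite exprD !rmorphM rmorphB !rmorphM /= -ea -eb mulrBl -!mulrA.
  by congr (_ - _ * _); rewrite mulrC.
- move=> x y /asboolP [k [a ea]] /asboolP [l [b eb]]; apply/asboolP.
  exists (k + l)%N, (a * b).
  by rewrite exprD !rmorphM /= -ea -eb mulrACA.
Qed.

HB.instance Definition _ := GRing.isSubringClosed.Build F loc_pred loc_pred_subring.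

Record loc := Loc { loc_val : F; _ : loc_val \in loc_pred }.
HB.instance Definition _ := [isSub for loc_val].
HB.instance Definition _ := [Choice of loc by <:].
HB.instance Definition _ := [SubChoice_isSubComNzRing of loc by <:].

Lemma loc_embed : exists iota : {rmorphism A -> loc}, forall a, val (iota a) = a%:F.
Proof.
have mem a : a%:F \in loc_pred.
  by apply/asboolP; exists 0%N, a; rewrite expr0 rmorph1 mulr1.
have [|||f fE] := @rmorphism_of A loc (fun a => Loc (mem a)).
- by move=> x y; apply: val_inj; exact: (rmorphD (@tofrac A)).
- by move=> x y; apply: val_inj; exact: (rmorphM (@tofrac A)).
- by apply: val_inj; exact: (rmorph1 (@tofrac A)).
by exists f => a; rewrite fE.
Qed.

Lemma loc_inv (iota : {rmorphism A -> loc}) :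
  (forall a, val (iota a) = a%:F) -> exists u, iota D * u = 1.
Proof.
move=> iotaE; have mem : (D%:F)^-1 \in loc_pred.
  apply/asboolP; exists 1%N, 1; rewrite expr1 mulVf ?rmorph1 //.
  by rewrite tofrac_eq0.
exists (Loc mem); apply: val_inj; rewrite -[LHS]/(val (iota D) * (D%:F)^-1).
by rewrite iotaE mulfV ?tofrac_eq0.
Qed.

(** Universal property of [A[1/D]]: the fraction [a / D^k] goes to [f a * u^k]. Equal fractions
    satisfy [a * D^l = b * D^k] already in [A], so this is well defined. *)
Lemma loc_extend (iota : {rmorphism A -> loc}) (S : comNzRingType)
    (f : {rmorphism A -> S}) (u : S) :
  (forall a, val (iota a) = a%:F) -> f D * u = 1 ->
  exists f' : {rmorphism loc -> S}, forall a, f' (iota a) = f a.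
Proof.
move=> iotaE fu.
have ukf k : f (D ^+ k) * u ^+ k = 1 by rewrite rmorphXn -exprMn fu expr1n.
have /choice [g gP] (x : loc) :
    exists s, forall k a, val x * (D ^+ k)%:F = a%:F -> s = f a * u ^+ k.
  have /asboolP [l [b eb]] := valP x; exists (f b * u ^+ l) => k a ea.
  have e : a * D ^+ l = b * D ^+ k.
    by apply/eqP; rewrite -tofrac_eq !rmorphM /= -ea -eb mulrAC.
  transitivity (f (b * D ^+ k) * u ^+ l * u ^+ k).
    by rewrite rmorphM -[LHS]mulr1 -(ukf k); ring.
  by rewrite -e rmorphM -[RHS]mulr1 -(ukf l); ring.
have gE x k a : val x * (D ^+ k)%:F = a%:F -> g x = f a * u ^+ k by apply: gP.
have rep (x : loc) : exists k a, val x * (D ^+ k)%:F = a%:F.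
  by have /asboolP := valP x.
have [|||f' f'E] := @rmorphism_of loc S g.
- move=> x y; have [k [a ea]] := rep x; have [l [b eb]] := rep y.
  rewrite (gE _ _ _ ea) (gE _ _ _ eb) (gE _ (k + l)%N (a * D ^+ l + b * D ^+ k)).
    rewrite rmorphD !rmorphM exprD mulrDl.
    transitivity (f a * u ^+ k * (f (D ^+ l) * u ^+ l)
                  + f b * u ^+ l * (f (D ^+ k) * u ^+ k)); first by ring.
    by rewrite !ukf !mulr1.
  rewrite [\val _](_ : _ = val x + val y) // exprD rmorphD !rmorphM /=
    -ea -eb -![loc_val _]/(val _).
  by ring.
- move=> x y; have [k [a ea]] := rep x; have [l [b eb]] := rep y.
  rewrite (gE _ _ _ ea) (gE _ _ _ eb) (gE _ (k + l)%N (a * b)).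
    by rewrite rmorphM exprD mulrACA.
  rewrite [\val _](_ : _ = val x * val y) // exprD !rmorphM /= -ea -eb.
  by rewrite mulrACA.
- by rewrite (gE _ 0%N 1) ?rmorph1 ?expr0 ?mulr1 // rmorph1 mulr1.
exists f' => a; rewrite f'E (gE _ 0%N a) ?expr0 ?mulr1 //.
Qed.

End Localization.

(** * Matrix families and the commutator map *)

(** By naturality [F] is determined by its value at the generic point of affine space, a polynomial;
    vanishing at all [K]-points, it is zero. *)
Lemma polynomial_identity (K : closedFieldType) (m : nat)
    (F : forall R : comNzRingType, {rmorphism K -> R} -> 'rV[R]_m -> R) :
    (forall (R S : comNzRingType) (rho : {rmorphism K -> R})
        (sigma : {rmorphism K -> S}) (f : {rmorphism R -> S}) (x : 'rV_m),
      (forall a, f (rho a) = sigma a) -> f (F R rho x) = F S sigma (map_mx f x)) ->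
    (forall x, F K idfun x = 0) ->
  forall R rho x, F R rho x = 0.
Proof.
move=> Fnat FK R rho x; pose X : 'rV[{mpoly K[m]}]_m := \row_i 'X_i.
suff F0 : F {mpoly K[m]} (@mpolyC m K) X = 0.
  have := Fnat _ _ (@mpolyC m K) rho (mmap rho (x 0)) X; rewrite F0 rmorph0 => ->.
    by congr F; apply/rowP => i; rewrite !mxE /= mmapX mmap1U.
  by move=> a; rewrite /= mmapC.
apply: meval_eq0 => v.
rewrite (Fnat _ _ (@mpolyC m K) idfun (meval v)) ?FK // => a /=.
by rewrite mevalC.
Qed.

Lemma mul_rV_linear (R : comNzRingType) (m n : nat) (h : 'rV[R]_m -> 'rV[R]_n) :
    (forall a u v, h (a *: u + v) = a *: h u + h v) ->
  forall v, v *m (\matrix_k h (delta_mx 0 k)) = h v.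
Proof.
move=> hL v; have h0 : h 0 = 0.
  have := hL 1 0 0; rewrite scaler0 addr0 scale1r => /eqP.
  by rewrite -subr_eq0 opprD addrA subrr sub0r oppr_eq0 => /eqP.
rewrite mulmx_sum_row [in RHS](row_sum_delta v).
have -> : h (\sum_j v 0 j *: delta_mx 0 j) = \sum_j v 0 j *: h (delta_mx 0 j).
  elim/big_rec2: _ => // i y1 y2 _ <-; exact: hL.
by apply: eq_bigr => i _; rewrite rowK.
Qed.

Section Families.
Variables (X : finType) (p q : X -> nat).

Definition mfam (R : Type) := forall x, 'M[R]_(p x, q x).
Definition mentry := {x : X & ('I_(p x) * 'I_(q x))%type}.

(** The entries come in the order of [coords], so polynomial functions on the representation space
    can be evaluated at [flat]. *)
Definition flat (R : Type) (F : mfam R) : 'rV[R]_#|{: mentry}| :=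
  \row_k F (tag (enum_val k)) (tagged (enum_val k)).1 (tagged (enum_val k)).2.

Definition unflat (R : Type) (v : 'rV[R]_#|{: mentry}|) : mfam R := fun x =>
  \matrix_(i, j) v 0 (enum_rank (Tagged (fun x => ('I_(p x) * 'I_(q x))%type) (i, j))).

Lemma flatK (R : Type) (F : mfam R) : unflat (flat F) = F.
Proof.
apply: functional_extensionality_dep => x; apply/matrixP => i j.
by rewrite !mxE enum_rankK.
Qed.

Lemma unflatK (R : Type) (v : 'rV[R]_#|{: mentry}|) : flat (unflat v) = v.
Proof.
apply/rowP => k; rewrite !mxE; congr (v 0 _).
by rewrite -[RHS]enum_valK; congr enum_rank; case: (enum_val k) => x [].
Qed.

Definition map_fam (R S : Type) (f : R -> S) (F : mfam R) : mfam S :=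
  fun x => map_mx f (F x).

Lemma map_flat (R S : Type) (f : R -> S) (F : mfam R) :
  map_mx f (flat F) = flat (map_fam f F).
Proof. by apply/rowP => k; rewrite !mxE. Qed.

Lemma map_unflat (R S : Type) (f : R -> S) v :
  map_fam f (unflat v) = unflat (map_mx f v).
Proof.
by apply: functional_extensionality_dep => x; apply/matrixP => i j; rewrite !mxE.
Qed.

Lemma flat_linear (R : comNzRingType) a (F G : mfam R) :
  flat (fun x => a *: F x + G x) = a *: flat F + flat G.
Proof. by apply/rowP => k; rewrite !mxE. Qed.

Lemma flatZ (R : comNzRingType) a (F : mfam R) :
  flat (fun x => a *: F x) = a *: flat F.
Proof. by apply/rowP => k; rewrite !mxE. Qed.

Lemma unflat_linear (R : comNzRingType) (a : R) u v x :
  unflat (a *: u + v) x = a *: unflat u x + unflat v x.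
Proof. by apply/matrixP => i j; rewrite !mxE. Qed.

End Families.

Section Commutator.
Variables (Q : quiver) (n : vert Q -> nat).

Definition mrep (R : Type) := mfam (fun a : arr Q => n (src a)) (fun a => n (tgt a)) R.
Definition mgl (R : Type) := mfam n n R.
Local Notation rep := mrep.
Local Notation gl := mgl.
Local Notation dR := #|{: mentry (fun a : arr Q => n (src a)) (fun a => n (tgt a))}|.
Local Notation dG := #|{: mentry n n}|.

(** Over a field, the kernel of this map in [phi] is [Hom(N, M)] and its cokernel is
    [Ext^1(N, M)]. *)
Definition bracket (R : comNzRingType) (M N : rep R) (phi : gl R) : rep R :=
  fun a => phi (src a) *m M a - N a *m phi (tgt a).

Definition bracket_mx (R : comNzRingType) (M N : rep R) : 'M[R]_(dG, dR) :=
  \matrix_k flat (bracket M N (unflat (delta_mx 0 k))).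

Lemma mul_bracket_mx (R : comNzRingType) (M N : rep R) v :
  v *m bracket_mx M N = flat (bracket M N (unflat v)).
Proof.
rewrite (mul_rV_linear (h := fun v => flat (bracket M N (unflat v)))) // => a u w.
rewrite -flat_linear; congr flat; apply: functional_extensionality_dep => x.
rewrite /bracket !unflat_linear mulmxDl mulmxDr -scalemxAl -scalemxAr opprD.
by rewrite addrACA -scalerBr.
Qed.

Lemma mul_flat_bracket_mx (R : comNzRingType) (M N : rep R) phi :
  flat phi *m bracket_mx M N = flat (bracket M N phi).
Proof. by rewrite mul_bracket_mx flatK. Qed.

Lemma map_bracket (R S : comNzRingType) (f : {rmorphism R -> S}) (M N : rep R) phi :
  map_fam f (bracket M N phi) = bracket (map_fam f M) (map_fam f N) (map_fam f phi).
Proof.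
apply: functional_extensionality_dep => a; rewrite /map_fam /bracket.
by rewrite map_mxB !map_mxM.
Qed.

Lemma map_bracket_mx (R S : comNzRingType) (f : {rmorphism R -> S}) (M N : rep R) :
  map_mx f (bracket_mx M N) = bracket_mx (map_fam f M) (map_fam f N).
Proof.
apply/row_matrixP => k; rewrite -map_row !rowK map_flat map_bracket map_unflat.
by rewrite map_delta_mx.
Qed.

Lemma bracket_mxZ (R : comNzRingType) s (M N : rep R) :
  bracket_mx (fun a => s *: M a) (fun a => s *: N a) = s *: bracket_mx M N.
Proof.
apply/row_matrixP => k; rewrite linearZ /= !rowK.
have -> : bracket (fun a => s *: M a) (fun a => s *: N a) (unflat (delta_mx 0 k)) =
    (fun a => s *: bracket M N (unflat (delta_mx 0 k)) a).
  apply: functional_extensionality_dep => a.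
  by rewrite /bracket -scalemxAl -scalemxAr -scalerBr.
by apply/rowP => j; rewrite !mxE.
Qed.

(** Division-free inverses up to one scalar common to all vertices, the product of all
    determinants. *)
Lemma gl_adjugate (R : comNzRingType) (G : gl R) : exists H : gl R,
  (forall i, G i *m H i = (\prod_j \det (G j))%:M) /\
  (forall i, H i *m G i = (\prod_j \det (G j))%:M).
Proof.
exists (fun i => (\prod_(j | j != i) \det (G j)) *: \adj (G i)); split=> i.
  by rewrite -scalemxAr mul_mx_adj scale_scalar_mx mulrC [in RHS](bigD1 i).
by rewrite -scalemxAl mul_adj_mx scale_scalar_mx mulrC [in RHS](bigD1 i).
Qed.

(* [LG] is [phi |-> G phi], and [LH] is [T |-> H T]. *)
Lemma bracket_conj (R : comNzRingType) (M N Y : rep R) (G H : gl R) (s c : R) :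
    (forall a, Y a *m G (tgt a) = s *: (G (src a) *m N a)) ->
    (forall i, H i *m G i = c%:M) ->
  exists (LG : 'M[R]_dG) (LH : 'M[R]_dR),
    LG *m bracket_mx (fun a => s *: M a) Y *m LH = (c * s) *: bracket_mx M N.
Proof.
move=> YG HG.
exists (\matrix_k flat (fun i => G i *m unflat (delta_mx 0 k) i)).
exists (\matrix_k flat (fun a => H (src a) *m unflat (delta_mx 0 k) a)).
apply/row_matrixP => k; rewrite [in RHS]linearZ /= 2!rowE -!mulmxA.
move: (delta_mx _ _) => u; rewrite !mulmxA.
rewrite (mul_rV_linear (h := fun v => flat (fun i => G i *m unflat v i))); last first.
  move=> x v w; rewrite -flat_linear; congr flat.
  apply: functional_extensionality_dep => i.
  by rewrite unflat_linear mulmxDr -scalemxAr.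
rewrite mul_flat_bracket_mx.
rewrite (mul_rV_linear (h := fun v => flat (fun a => H (src a) *m unflat v a)));
  last first.
  move=> x v w; rewrite -flat_linear; congr flat.
  apply: functional_extensionality_dep => i.
  by rewrite unflat_linear mulmxDr -scalemxAr.
rewrite flatK mul_bracket_mx -flatZ; congr flat.
apply: functional_extensionality_dep => a; rewrite /bracket mulmxA YG.
rewrite -scalemxAl -scalemxAr -mulmxA -scalerBr -mulmxA -mulmxBr.
by rewrite -scalemxAr mulmxA HG mul_scalar_mx scalerA mulrC.
Qed.

End Commutator.

Lemma mul_pidE (R : comNzRingType) (m n r : nat) (A : 'M[R]_(m, n)) i j :
  (pid_mx r *m A) i j = if (i < r)%N then A i j else 0.
Proof.
rewrite mxE (bigD1 i) //= big1 ?addr0 => [|k ki].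
  by rewrite mxE eqxx /=; case: ifP; rewrite ?mul1r ?mul0r.
by rewrite mxE eq_sym (inj_eq val_inj) (negbTE ki) mul0r.
Qed.

Lemma mulmx_pidE (R : comNzRingType) (m n r : nat) (A : 'M[R]_(m, n)) i j :
  (A *m pid_mx r) i j = if (j < r)%N then A i j else 0.
Proof.
rewrite mxE (bigD1 j) //= big1 ?addr0 => [|k ki].
  by rewrite mxE eqxx /=; case: ifP; rewrite ?mulr1 ?mulr0.
by rewrite mxE (inj_eq val_inj) (negbTE ki) mulr0.
Qed.

Lemma det_low_rank (F : fieldType) (p q r : nat) (A : 'M[F]_(p, q))
    (C : 'M[F]_(r.+1, p)) (D : 'M[F]_(q, r.+1)) :
  (\rank A <= r)%N -> \det (C *m A *m D) = 0.
Proof.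
move=> rA; apply/eqP; apply: contraLR rA => det0; rewrite -ltnNge.
have <- : \rank (C *m A *m D) = r.+1 by rewrite mxrank_unit // unitmxE unitfE.
by apply: leq_trans (mxrankM_maxl _ _) _; exact: mxrankM_maxr.
Qed.

(** * Representations preserving the coordinate flag *)

Section Standard.
Variables (K : closedFieldType) (Q : quiver) (nu : nat) (d : filtration Q nu).
Local Notation n := (d ord_max).
Local Notation rep := (mrep n).
Local Notation dR := #|{: mentry (fun a : arr Q => n (src a)) (fun a => n (tgt a))}|.
Local Notation dG := #|{: mentry n n}|.

Definition stdflag (R : comNzRingType) (k : 'I_nu.+1) (i : vert Q) : 'M[R]_(n i) :=
  pid_mx (d k i).

(* The representations preserving the coordinate flag whose [k]-th member at
   the vertex [i] is spanned by the first [d k i] basis vectors. *)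
Definition std (R : comNzRingType) (Y : rep R) : Prop := forall k a,
  stdflag R k (src a) *m Y a *m stdflag R k (tgt a) = stdflag R k (src a) *m Y a.

Lemma map_stdflag (R S : comNzRingType) (f : {rmorphism R -> S}) k i :
  map_mx f (stdflag R k i) = stdflag S k i.
Proof. exact: map_pid_mx. Qed.

Lemma stdP (R : comNzRingType) (Y : rep R) :
  std Y <-> forall (k : 'I_nu.+1) a (p : 'I_(n (src a))) (q : 'I_(n (tgt a))),
    (p < d k (src a))%N -> (d k (tgt a) <= q)%N -> Y a p q = 0.
Proof.
split=> [stdY k a p q pk qk|H k a].
  have /matrixP/(_ p q) := stdY k a; rewrite mulmx_pidE mul_pidE pk.
  by rewrite ltnNge qk.
apply/matrixP => p q; rewrite mulmx_pidE mul_pidE.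
by case: ltnP => // qk; case: ltnP => // pk; rewrite (H k).
Qed.

(** A retraction onto the representations satisfying [std], compatible with ring maps: it
    parametrizes them by an affine space, as [polynomial_identity] requires. *)
Definition stdproj (R : comNzRingType) (Y : rep R) : rep R := fun a =>
  \matrix_(p, q) if [exists k, (p < d k (src a)) && (d k (tgt a) <= q)]%N then 0
                 else Y a p q.

Lemma stdproj_std (R : comNzRingType) (Y : rep R) : std (stdproj Y).
Proof.
apply/stdP => k a p q pk qk; rewrite mxE.
case: ifP => // /negbT; rewrite negb_exists => /fintype.forallP /(_ k).
by rewrite pk qk.
Qed.

Lemma stdproj_id (R : comNzRingType) (Y : rep R) : std Y -> stdproj Y = Y.
Proof.
move=> /stdP stdY; apply: functional_extensionality_dep => a.
apply/matrixP => p q; rewrite mxE.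
by case: ifP => // /fintype.existsP [k /andP [pk qk]]; rewrite (stdY k).
Qed.

Lemma map_stdproj (R S : comNzRingType) (f : {rmorphism R -> S}) (Y : rep R) :
  map_fam f (stdproj Y) = stdproj (map_fam f Y).
Proof.
apply: functional_extensionality_dep => a; apply/matrixP => p q; rewrite !mxE.
by case: ifP => //; rewrite rmorph0.
Qed.

Lemma stdZ (R : comNzRingType) s (Y : rep R) : std Y -> std (fun a => s *: Y a).
Proof.
by move=> stdY k a; rewrite -scalemxAr -scalemxAl stdY.
Qed.

Lemma map_std (R S : comNzRingType) (f : {rmorphism R -> S}) (Y : rep R) :
  std Y -> std (map_fam f Y).
Proof.
by move=> stdY k a; rewrite /map_fam -!(map_stdflag f) -!map_mxM stdY.
Qed.

(** The left side is polynomial in [(s, Y, C, D)], so [K]-points suffice. There, for nonzero [s],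
    the matrix is [s] times that of [M] and [s^-1 Y], of rank at most [r]; the outer factor settles
    [s = 0]. The scalar will absorb the denominators of a conjugation. *)
Lemma std_minor (M : rep K) (r : nat) :
    (forall Y : rep K, std Y -> (\rank (bracket_mx M Y) <= r)%N) ->
  forall (R : comNzRingType) (rho : {rmorphism K -> R}) (s : R) (Y : rep R)
    (C : 'M[R]_(r.+1, dG)) (D : 'M[R]_(dR, r.+1)), std Y ->
  s * \det (C *m bracket_mx (fun a => s *: map_fam rho M a) Y *m D) = 0.
Proof.
move=> rkM R rho s Y C D stdY.
pose F (R : comNzRingType) (rho : {rmorphism K -> R})
   (x : 'rV[R]_(1 + (dR + (r.+1 * dG + dR * r.+1)))) : R :=
  lsubmx x 0 0 *
  \det (vec_mx (lsubmx (rsubmx (rsubmx x))) *m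
        bracket_mx (fun a => lsubmx x 0 0 *: map_fam rho M a)
                (stdproj (unflat (lsubmx (rsubmx x)))) *m
        vec_mx (rsubmx (rsubmx (rsubmx x)))).
suff F0 : forall R rho x, F R rho x = 0.
  have := F0 R rho (row_mx (s%:M) (row_mx (flat Y) (row_mx (mxvec C) (mxvec D)))).
  rewrite /F !(row_mxKl, row_mxKr) !mxvecK flatK stdproj_id //.
  by rewrite mxE eqxx mulr1n.
apply: polynomial_identity => [R1 S rho1 sigma f x fE|x]; rewrite /F.
  rewrite rmorphM -det_map_mx !map_mxM map_bracket_mx map_stdproj map_unflat.
  rewrite !map_vec_mx !map_lsubmx !map_rsubmx.
  have -> : f (lsubmx x 0 0) = lsubmx (map_mx f x) 0 0 by rewrite -map_lsubmx [RHS]mxE.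
  suff -> : map_fam f (fun a => lsubmx x 0 0 *: map_fam rho1 M a) =
    (fun a => lsubmx (map_mx f x) 0 0 *: map_fam sigma M a) by [].
  apply: functional_extensionality_dep => a; apply/matrixP => p q.
  by rewrite -map_lsubmx !mxE rmorphM /= fE.
set C' := vec_mx _; set D' := vec_mx (rsubmx _); set c := lsubmx x 0 0.
have [->|cn0] := eqVneq c 0; first by rewrite mul0r.
apply/eqP; rewrite mulf_eq0 (negbTE cn0) /=.
set Z := stdproj _; have stdZ' : std Z by apply: stdproj_std.
apply/eqP/det_low_rank.
have -> : bracket_mx (fun a => c *: map_fam idfun M a) Z =
    c *: bracket_mx M (fun a => c^-1 *: Z a).
  rewrite -bracket_mxZ; congr bracket_mx; apply: functional_extensionality_dep => a.
    by rewrite /map_fam map_mx_id.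
  by rewrite scalerA mulfV // scale1r.
by rewrite mxrank_scale_nz //; apply: rkM; apply: stdZ.
Qed.

End Standard.

(** * Flags as chains of idempotents *)

(** Idempotents (case [j = k]) whose row spaces increase and whose kernels decrease. *)
Definition chain (R : comNzRingType) (n : nat) (E : nat -> 'M[R]_n) : Prop :=
  forall j k, (j <= k)%N -> E j *m E k = E j /\ E k *m E j = E j.

(** For a chain these are orthogonal idempotents onto the graded pieces; below level 0 lies the zero
    subspace. *)
Definition gr (R : comNzRingType) (n : nat) (E : nat -> 'M[R]_n) (k : nat) : 'M[R]_n :=
  E k - (if k is j.+1 then E j else 0).

Lemma chain_pid (R : comNzRingType) (n : nat) (r : nat -> nat) :
    (forall j k, (j <= k)%N -> (r j <= r k)%N) ->
  chain (fun k => pid_mx (r k) : 'M[R]_n).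
Proof.
move=> rle j k /rle jk; split; apply/matrixP => p q; rewrite mul_pidE !mxE.
  by case: (ltnP p (r j)) => pj; rewrite ?andbT ?andbF // (leq_trans pj jk) andbT.
have [->|//] := eqVneq (p : nat) q; rewrite /= ?if_same //.
by case: (ltnP q (r j)) => qj; rewrite ?(leq_trans qj jk) ?if_same.
Qed.

Section Chain.
Variables (R : comNzRingType) (n : nat) (E : nat -> 'M[R]_n).
Hypothesis chE : chain E.

Lemma gr_sum k : \sum_(j < k.+1) gr E j = E k.
Proof.
elim: k => [|k IH]; first by rewrite big_ord1 /gr subr0.
by rewrite big_ord_recr /= IH /gr addrC subrK.
Qed.

Lemma gr_mulr j k : gr E j *m E k = if (j <= k)%N then gr E j else 0.
Proof.
rewrite /gr mulmxBl; have [jk|kj] := leqP j k.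
  rewrite (chE jk).1; case: j jk => [|j] jk; first by rewrite mul0mx.
  by rewrite (chE (ltnW jk)).1.
case: j kj => // j; rewrite ltnS => kj.
by rewrite (chE (leqW kj)).2 (chE kj).2 subrr.
Qed.

Lemma gr_mull j k : E k *m gr E j = if (j <= k)%N then gr E j else 0.
Proof.
rewrite /gr mulmxBr; have [jk|kj] := leqP j k.
  rewrite (chE jk).2; case: j jk => [|j] jk; first by rewrite mulmx0.
  by rewrite (chE (ltnW jk)).2.
case: j kj => // j; rewrite ltnS => kj.
by rewrite (chE (leqW kj)).1 (chE kj).1 subrr.
Qed.

Lemma gr_mul j k : gr E j *m gr E k = if j == k then gr E k else 0.
Proof.
rewrite {2}/gr mulmxBr gr_mulr; case: k => [|k].
  by rewrite mulmx0 subr0 leqn0; case: j.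
rewrite gr_mulr; have [jk|kj] := leqP j k.
  by rewrite (leqW jk) subrr ltn_eqF.
rewrite subr0; have [->|ne] := eqVneq j k.+1; first by rewrite leqnn.
by rewrite leqNgt ltn_neqAle eq_sym ne kj.
Qed.

End Chain.

(* Any matrix is turned into an intertwiner of two chains by keeping its
   components between homologous graded pieces. *)
Lemma intertwine (R : comNzRingType) (n nu : nat) (E E' g : nat -> 'M[R]_n) k :
    chain E -> chain E' -> (k <= nu)%N ->
  (\sum_(j < nu.+1) gr E' j *m g j *m gr E j) *m E k =
  E' k *m (\sum_(j < nu.+1) gr E' j *m g j *m gr E j).
Proof.
move=> chE chE' kn; rewrite mulmx_suml mulmx_sumr; apply: eq_bigr => j _.
rewrite -mulmxA gr_mulr // !mulmxA gr_mull //.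
by case: ifP; rewrite ?mulmx0 ?mul0mx.
Qed.

Lemma map_chain (R S : comNzRingType) (f : {rmorphism R -> S}) (n : nat)
  (E : nat -> 'M[R]_n) : chain E -> chain (fun k => map_mx f (E k)).
Proof. by move=> chE j k /chE [e1 e2]; rewrite -!map_mxM e1 e2. Qed.

Lemma map_gr (R S : comNzRingType) (f : {rmorphism R -> S}) (n : nat)
  (E : nat -> 'M[R]_n) k : map_mx f (gr E k) = gr (fun k => map_mx f (E k)) k.
Proof. by rewrite map_mxB; case: k => // ; rewrite map_mx0. Qed.

Lemma rank_gr (L : fieldType) (n : nat) (E : nat -> 'M[L]_n) k : chain E ->
  \rank (gr E k) = (\rank (E k) - (if k is j.+1 then \rank (E j) else 0))%N.
Proof.
move=> chE; case: k => [|k]; first by rewrite /gr subr0 subn0.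
have -> : \rank (E k.+1) = (\rank (E k) + \rank (gr E k.+1))%N.
  rewrite -mxrank_disjoint_sum; last first.
    apply/eqP/rowV0P => v; rewrite sub_capmx => /andP [/submxP [a ->] /submxP [b ab]].
    have : a *m E k *m E k = 0 by rewrite ab -mulmxA gr_mulr // ltnn mulmx0.
    by rewrite -mulmxA (chE k k (leqnn k)).1.
  apply: eqmx_rank; apply/andP; split.
    rewrite -{1}[E k.+1](subrK (E k)) addrC; exact: addmx_sub_adds.
  rewrite addsmx_sub -{1}(chE _ _ (leqnSn k)).1 submxMl /=.
  by rewrite -[gr E k.+1](_ : gr E k.+1 *m E k.+1 = _) ?submxMl // gr_mulr ?leqnn.
by rewrite addKn.
Qed.

(** Equal ranks make homologous graded pieces isomorphic; the sum of such isomorphisms intertwines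
    the chains, and it is invertible because the pieces of [E] span everything. *)
Lemma conj_chain (L : fieldType) (n nu : nat) (E E' : nat -> 'M[L]_n) :
    chain E -> chain E' -> (forall k, \rank (E k) = \rank (E' k)) -> E nu = 1%:M ->
  (* [h k] has the row space of [gr E k] and its column space lies in that of [gr E' k]. *)
  exists g, g \in unitmx /\ forall k, (k <= nu)%N -> g *m E k = E' k *m g.
Proof.
move=> chE chE' rk E1; pose h (k : nat) : 'M[L]_n :=
  col_ebase (gr E' k) *m pid_mx (\rank (gr E k)) *m row_ebase (gr E k).
pose g := \sum_(j < nu.+1) gr E' j *m h j *m gr E j.
have rkg k : \rank (gr E k) = \rank (gr E' k).
  by rewrite !rank_gr // rk; case: k => // k; rewrite rk.
have h1 k : gr E' k *m h k = h k.
  rewrite /h !mulmxA; congr (_ *m _).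
  have : gr E' k *m gr E' k = gr E' k by rewrite gr_mul // eqxx.
  rewrite -{2 3}(mulmx_ebase (gr E' k)) -rkg !mulmxA.
  by move/(can_inj (mulmxK (row_ebase_unit _))).
have h2 k : (h k :=: gr E k)%MS.
  rewrite -[in X in (_ :=: X)%MS](mulmx_ebase (gr E k)) /h -!mulmxA.
  apply: (eqmx_trans (eqmxMfull _ _)); first by rewrite row_full_unit col_ebase_unit.
  by apply/eqmx_sym/eqmxMfull; rewrite row_full_unit col_ebase_unit.
clearbody h; exists g; split; last by move=> k kn; apply: intertwine.
rewrite -row_full_unit -sub1mx -E1 -(gr_sum E nu).
apply: summx_sub => j _; rewrite -h2; apply: submx_trans (submxMl (gr E' j) g).
rewrite /g mulmx_sumr (bigD1 j) //= big1 ?addr0 => [|i ij]; last first.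
  by rewrite !mulmxA gr_mul // (inj_eq val_inj) eq_sym (negbTE ij) !mul0mx.
rewrite !mulmxA gr_mul // eqxx h1; have /submxP [a ea] : (h j <= gr E j)%MS by rewrite h2.
by rewrite ea -mulmxA gr_mul // eqxx.
Qed.

(** An entrywise lift of the conjugating matrix is made an intertwiner by [intertwine]; its
    reduction is unchanged, since that matrix was one already. *)
Lemma lift_conj_chain (R : comNzRingType) (L : fieldType) (f : {rmorphism R -> L})
    (n nu : nat) (E E' : nat -> 'M[R]_n) :
    (forall y, exists x, f x = y) -> chain E -> chain E' ->
    (forall k, \rank (map_mx f (E k)) = \rank (map_mx f (E' k))) ->
    E nu = 1%:M -> E' nu = 1%:M ->
  exists G, f (\det G) != 0 /\ forall k, (k <= nu)%N -> G *m E k = E' k *m G.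
Proof.
move=> /choice [s fs] chE chE' rk E1 E1'.
have [g [gU gE]] := conj_chain (map_chain f chE) (map_chain f chE') rk
  (etrans (congr1 _ E1) (map_mx1 f n)).
exists (\sum_(j < nu.+1) gr E' j *m map_mx s g *m gr E j).
split; last by move=> k kn; apply: (intertwine (fun=> _)).
rewrite -det_map_mx (_ : map_mx f _ = g) -?unitfE -?unitmxE //.
have sg : map_mx f (map_mx s g) = g by apply/matrixP => i j; rewrite !mxE fs.
rewrite map_mx_sum (eq_bigr (fun j : 'I_nu.+1 => g *m map_mx f (gr E j))).
  rewrite -mulmx_sumr -map_mx_sum gr_sum E1 map_mx1 mulmx1 //.
move=> j _; rewrite !map_mxM sg !map_gr.
suff -> : gr (fun k => map_mx f (E' k)) j *m g = g *m gr (fun k => map_mx f (E k)) j.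
  by rewrite -mulmxA gr_mul ?eqxx //; apply: map_chain.
move: (nat_of_ord j) (ltn_ord j) => i; rewrite ltnS => jn; rewrite /gr mulmxBl mulmxBr /=.
rewrite gE //; congr (_ - _).
by case: i jn => [|i] jn; rewrite ?mulmx0 ?mul0mx // gE // ltnW.
Qed.

(** * Vanishing of minors for representations with a flag over any algebra *)

Section FlagMinor.
Variables (K : closedFieldType) (Q : quiver) (nu : nat) (d : filtration Q nu).
Local Notation n := (d ord_max).
Local Notation rep := (mrep n).
Local Notation gl := (mgl n).
Local Notation dR := #|{: mentry (fun a : arr Q => n (src a)) (fun a => n (tgt a))}|.
Local Notation dG := #|{: mentry n n}|.

(** The filtration continued constantly beyond [nu], to match chains indexed by all naturals. *)
Definition fdimn (k : nat) : dimvec Q := d (inord (minn k nu)).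

Lemma fdimnE (k : 'I_nu.+1) : fdimn k = d k.
Proof.
by rewrite /fdimn (minn_idPl _) ?inord_val // -ltnS.
Qed.

Lemma fdimn_max k : (nu <= k)%N -> fdimn k = n.
Proof.
move=> kn; rewrite /fdimn (minn_idPr kn); congr (d _).
by apply: val_inj; rewrite /= inordK.
Qed.

Lemma fdimn_le i j k : (j <= k)%N -> (fdimn j i <= fdimn k i)%N.
Proof.
elim: k => [|k IH]; first by rewrite leqn0 => /eqP ->.
rewrite leq_eqVlt => /predU1P [-> //|]; rewrite ltnS => /IH jk.
apply: (leq_trans jk); have [kn|nk] := ltnP k nu.
  apply: fdim_le; rewrite !inordK ?ltnS ?geq_minr //.
  by rewrite !(minn_idPl _) // ltnW.
by rewrite !fdimn_max // leqW.
Qed.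

Definition stdchain (R : comNzRingType) (k : nat) : gl R := fun i => pid_mx (fdimn k i).

Lemma stdchainE (R : comNzRingType) (k : 'I_nu.+1) i : stdchain R k i = stdflag d R k i.
Proof. by rewrite /stdchain fdimnE. Qed.

Lemma chain_std (R : comNzRingType) i : chain (fun k => stdchain R k i).
Proof. by apply: chain_pid => j k; apply: fdimn_le. Qed.

Lemma rank_stdchain (L : fieldType) k i : \rank (stdchain L k i) = fdimn k i.
Proof.
have kn : (fdimn k i <= n i)%N.
  by rewrite -[n i](_ : fdimn (maxn k nu) i = _) ?fdimn_le ?leq_maxl ?fdimn_max ?leq_maxr.
by rewrite /stdchain rank_pid_mx.
Qed.

(* A flag of subrepresentations, given by projections onto its members. *)
Record idflag (R : comNzRingType) (N : rep R) (E : nat -> gl R) : Prop := IdFlag {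
  idflag_chain : forall i, chain (fun k => E k i);
  idflag_rank : forall (L : fieldType) (f : {rmorphism R -> L}) k i,
    \rank (map_mx f (E k i)) = fdimn k i;
  idflag_stab : forall k a,
    E k (src a) *m N a *m E k (tgt a) = E k (src a) *m N a;
  idflag_max : forall k i, (nu <= k)%N -> E k i = 1%:M
}.

(** Locally on [Spec R] the flag is conjugate to the coordinate flag, where [std_minor] applies. *)
Lemma flag_minor (M : repspace K n) (r : nat) :
    (forall Y : rep K, std Y -> (\rank (bracket_mx M Y) <= r)%N) ->
  forall (R : comNzRingType) (rho : {rmorphism K -> R}) (N : rep R) (E : nat -> gl R)
    (C : 'M[R]_(r.+1, dG)) (D : 'M[R]_(dR, r.+1)), idflag N E ->
  \det (C *m bracket_mx (map_fam rho M) N *m D) = 0.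
Proof.
move=> rkM R rho N E C D [chE rkE stE maxE]; set x := \det _.
apply: contrapT => xn0.
(* A nonzero [x] has a proper annihilator; [L] is the residue field at a maximal ideal containing
   it. *)
have [|y z yx zx|a y yx||L [f [fs fI]]] := @residue_field R [set a | a * x = 0].
- by rewrite /= mul0r.
- by rewrite /= mulrBl yx zx subrr.
- by rewrite /= -mulrA yx mulr0.
- by rewrite /= mul1r.
have exG i : exists G, f (\det G) != 0 /\
    forall k, (k <= nu)%N -> G *m E k i = stdchain R k i *m G.
  apply: lift_conj_chain => //; [exact: chain_std| |exact: maxE|].
    by move=> k; rewrite rkE (map_pid_mx f) -/(stdchain L k i) rank_stdchain.
  by rewrite /stdchain fdimn_max // pid_mx_1.
pose G i := projT1 (cid (exG i)).
have Gn0 i : f (\det (G i)) != 0 by rewrite /G; case: cid => ? [].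
have GE k i : (k <= nu)%N -> G i *m E k i = stdchain R k i *m G i.
  by rewrite /G; case: cid => ? [? +]; apply.
pose Delta := \prod_i \det (G i).
have [H [GH HG]] := gl_adjugate G; rewrite -/Delta in GH HG.
(* [H] is an inverse of [G] only up to [Delta], which may be a zero divisor, so the relation is
   transferred after multiplication by [Delta]. Hence the extra factor [Delta] in [Y]. *)
have EH k i : (k <= nu)%N -> Delta *: (E k i *m H i) = Delta *: (H i *m stdchain R k i).
  move=> kn; rewrite -mul_scalar_mx -(HG i) mulmxA -[H i *m G i *m _]mulmxA GE //.
  by rewrite -!mulmxA GH !mul_mx_scalar -scalemxAr.
pose Y : rep R := fun a => Delta *: (G (src a) *m N a *m H (tgt a)).
have stdY : std Y.
  move=> k a; rewrite -!stdchainE /Y.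
  have kn : (k <= nu)%N by rewrite -ltnS.
  transitivity (G (src a) *m E k (src a) *m N a *m
                (Delta *: (H (tgt a) *m stdchain R k (tgt a)))).
    by rewrite GE // -!scalemxAr -scalemxAl !mulmxA.
  rewrite -EH // -!scalemxAr !mulmxA -GE //; congr (_ *: (_ *m _)).
  by rewrite -!mulmxA [E k _ *m (N a *m _)]mulmxA stE.
have YG a : Y a *m G (tgt a) = Delta ^+ 2 *: (G (src a) *m N a).
  by rewrite /Y -scalemxAl -[_ *m H _ *m G _]mulmxA HG mul_mx_scalar scalerA.
have [LG [LH conjE]] := bracket_conj (map_fam rho M) YG HG.
(* A power of [Delta] kills [x], so it maps to 0 in [L], although each determinant in [Delta] maps
   to a nonzero element. *)
have := std_minor rkM rho (Delta ^+ 2) (C *m LG) (LH *m D) stdY.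
rewrite !mulmxA -[C *m LG *m _]mulmxA -[C *m _ *m LH]mulmxA conjE.
rewrite -scalemxAr -scalemxAl detZ -/x -exprS -exprM mulrA -exprD => /fI.
rewrite rmorphXn => /eqP; rewrite expf_eq0 => /andP [_].
by rewrite rmorph_prod; apply/negP/prodf_neq0 => i _; apply: Gn0.
Qed.

End FlagMinor.

(** * Translation between flags of direct summands and chains of idempotents *)

Lemma chain_step (R : comNzRingType) (n : nat) (E : nat -> 'M[R]_n) :
    (forall k, E k *m E k = E k) ->
    (forall k, E k *m E k.+1 = E k /\ E k.+1 *m E k = E k) -> chain E.
Proof.
move=> idE stepE j k; elim: k => [|k IH]; first by rewrite leqn0 => /eqP ->.
rewrite leq_eqVlt => /predU1P [-> //|]; rewrite ltnS => /IH [e1 e2].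
by split; [rewrite -e1 -mulmxA (stepE k).1|rewrite -e2 mulmxA (stepE k).2].
Qed.

(** Arbitrary projections onto the members need not have nested kernels. Descending from the top and
    composing each with the projection above it makes the kernels nested. *)
Lemma chain_of_summands (R : comNzRingType) (n nu : nat) (U : nat -> set 'rV[R]_n) :
    (forall k, direct_summand (U k)) -> (forall k, U k `<=` U k.+1) ->
    (forall k, (nu <= k)%N -> U k = setT) ->
  exists E, [/\ chain E, forall k v, U k v <-> v *m E k = v
    & forall k, (nu <= k)%N -> E k = 1%:M].
Proof.
move=> sU Ule UT.
have /choice [e eP] k := (direct_summandP (U k)).1 (sU k).
pose P := nat_rect (fun=> 'M[R]_n) 1%:M (fun j X => X *m e (nu - j.+1)%N).
have PS j : P j.+1 = P j *m e (nu - j.+1)%N by [].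
have Ue k m (A : 'M_(m, n)) : (forall i, U k (row i A)) -> A *m e k = A.
  by move=> UA; apply/row_matrixP => i; rewrite row_mul; apply/(eP k).2.
have UP j : P j *m P j = P j /\ forall v, U (nu - j)%N v <-> v *m P j = v.
  elim: j => [|j [idP UP]].
    by rewrite /= mulmx1 subn0 UT //; split=> // v; rewrite mulmx1.
  have UPj v : U (nu - j.+1)%N v -> v *m P j = v.
    move=> Uv; apply/UP; have [nj|jn] := leqP nu j.
      by move: Uv; rewrite (eqP nj) (eqP (leqW nj)).
    by rewrite -subnSK //; apply: Ule.
  have eP' : e (nu - j.+1)%N *m P j = e (nu - j.+1)%N.
    apply/row_matrixP => i; rewrite row_mul; apply/UPj/(eP _).2.
    by rewrite -row_mul (eP _).1.
  split; first by rewrite !PS mulmxA -[P j *m _ *m P j]mulmxA eP' -mulmxA (eP _).1.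
  move=> v; rewrite PS mulmxA; split=> [Uv|vE].
    by rewrite UPj //; apply/(eP _).2.
  by apply/(eP _).2; rewrite -{1}vE -mulmxA (eP _).1.
have PP j : P j *m P j.+1 = P j.+1 /\ P j.+1 *m P j = P j.+1.
  split; first by rewrite PS mulmxA (UP j).1.
  apply/row_matrixP => i; rewrite row_mul; apply/(UP j).2.
  have : U (nu - j.+1)%N (row i (P j.+1)).
    by apply/(UP j.+1).2; rewrite -row_mul (UP j.+1).1.
  have [nj|jn] := leqP nu j; first by rewrite (eqP nj) (eqP (leqW nj)).
  by move=> Uv; rewrite -subnSK //; apply: Ule.
have E1 k : (nu <= k)%N -> P (nu - k)%N = 1%:M by rewrite -subn_eq0 => /eqP ->.
exists (fun k => P (nu - k)%N); split=> //.
  apply: chain_step => k; first by case: (UP (nu - k)%N).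
  have [nk|kn] := leqP nu k; first by rewrite !E1 ?leqW // mulmx1.
  by rewrite -subnSK //; case: (PP (nu - k.+1)%N).
move=> k v; have [nk|kn] := leqP nu k; first by rewrite UT // E1 // mulmx1.
by rewrite -(UP _).2 subKn // ltnW.
Qed.

Lemma base_change_im (R S : comNzRingType) (f : {rmorphism R -> S}) (n : nat)
    (U : set 'rV[R]_n) (E : 'M[R]_n) :
    E *m E = E -> (forall v, U v <-> v *m E = v) ->
  forall v, base_change f U v <-> v *m map_mx f E = v.
Proof.
move=> idE UE v; split.
  move=> [m [a [B [HB ->]]]]; rewrite -mulmxA -map_mxM; congr (_ *m map_mx _ _).
  by apply/row_matrixP => i; rewrite row_mul; apply/UE.
move=> <-; exists n, v, E; split=> // i.
by apply/UE; rewrite -row_mul idE.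
Qed.

Lemma has_rank_im (R : comNzRingType) (n : nat) (U : set 'rV[R]_n) (E : 'M[R]_n) r :
    E *m E = E -> (forall v, U v <-> v *m E = v) ->
  has_rank U r <-> forall (L : fieldType) (f : {rmorphism R -> L}),
    \rank (map_mx f E) = r.
Proof.
move=> idE UE.
have subE (L : fieldType) (f : {rmorphism R -> L}) (v : 'rV_n) :
    v *m map_mx f E = v <-> (v <= map_mx f E)%MS.
  split=> [<-|/submxP [a ->]]; first exact: submxMl.
  by rewrite -mulmxA -map_mxM idE.
split=> H L f; have base := base_change_im f idE UE.
  have [B [fB BE]] := H L f; rewrite -(eqP fB); apply/esym/eqmx_rank/andP; split.
    by apply/row_subP => i; apply/subE/base/BE; exact: row_sub.
  by apply/row_subP => i; apply/BE/base/subE; exact: row_sub.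
rewrite -(H L f); exists (row_base (map_mx f E)); split; first exact: row_base_free.
by move=> v; rewrite eq_row_base -subE; exact: base.
Qed.

Section FlagProjections.
Variables (K : closedFieldType) (Q : quiver) (nu : nat) (d : filtration Q nu).
Local Notation n := (d ord_max).
Local Notation rep := (mrep n).
Local Notation gl := (mgl n).
Local Notation algmap R := (in_alg R : {rmorphism K -> R}).

Lemma idflag_of_flag (M : repspace K n) (R : comAlgType K)
    (U : forall (k : 'I_nu.+1) (i : vert Q), set 'rV[R]_(n i)) : is_flag M U ->
  exists E : nat -> gl R, idflag (map_fam (algmap R) M) E /\
    forall (k : 'I_nu.+1) i v, U k i v <-> v *m E k i = v.
Proof.
move=> [sU rU aU leU maxU]; pose V (k : nat) i := U (inord (minn k nu)) i.
have VE (k : 'I_nu.+1) i : V k i = U k i.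
  by rewrite /V (minn_idPl _) ?inord_val // -ltnS.
have exE i : exists E, [/\ chain E, forall k v, V k i v <-> v *m E k = v
    & forall k, (nu <= k)%N -> E k = 1%:M].
  apply: chain_of_summands => [k|k|k kn]; first exact: sU.
    have [kn|nk] := ltnP k nu.
      apply: leU; rewrite !inordK ?ltnS ?geq_minr //.
      by rewrite !(minn_idPl _) // ltnW.
    by rewrite /V !(minn_idPr _) // leqW.
  rewrite /V (minn_idPr kn) -[inord nu](_ : ord_max = _) ?maxU //.
  by apply: val_inj; rewrite /= inordK.
pose E k i := projT1 (cid (exE i)) k.
have [chE VEE maxE] : [/\ forall i, chain (fun k => E k i),
   forall k i v, V k i v <-> v *m E k i = v & forall k i, (nu <= k)%N -> E k i = 1%:M].
  by split=> [i|k i|k i]; rewrite /E; case: (cid (exE i)) => e [] /= c1 c2 c3;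
    [exact: c1|exact: c2|exact: c3].
exists E; split; last by move=> k i v; rewrite -VEE VE.
split=> // [L f k i|k a].
- have idE : E k i *m E k i = E k i by case: (chE i k k (leqnn k)).
  exact: ((has_rank_im _ idE (VEE k i)).1 (rU _ i) L f).
- apply/row_matrixP => i; rewrite row_mul; apply/VEE; rewrite row_mul.
  by apply: aU; apply/VEE; rewrite -row_mul; case: (chE (src a) k k (leqnn k)) => ->.
Qed.

Lemma flag_of_idflag (M : repspace K n) (R : comAlgType K) (E : nat -> gl R) :
    idflag (map_fam (algmap R) M) E ->
  is_flag M (fun (k : 'I_nu.+1) i => [set v : 'rV[R]_(n i) | v *m E k i = v]).
Proof.
move=> [chE rkE stE maxE].
have idE k i : E k i *m E k i = E k i by case: (chE i k k (leqnn k)).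
split.
- by move=> k i; apply/direct_summandP; exists (E k i).
- move=> k i; apply/(has_rank_im (E := E k i)) => // L f.
  by rewrite rkE fdimnE.
- move=> k a v /= vE; have := stE k a; rewrite /map_fam /= => st.
  by rewrite -vE -mulmxA -[v *m _ *m _]mulmxA [E k _ *m (_ *m _)]mulmxA st -mulmxA.
- by move=> k l kl i v /= vE; rewrite -vE -mulmxA kl (chE i _ _ (leqnSn k)).1.
- by move=> i; apply/seteqP; split=> // v _ /=; rewrite maxE ?mulmx1.
Qed.

Lemma conj_idflag (R : comNzRingType) (N N' : rep R) (E : nat -> gl R) (h h' : gl R) :
    (forall i, h i *m h' i = 1%:M) -> (forall i, h' i *m h i = 1%:M) ->
    (forall a, N a *m h (tgt a) = h (src a) *m N' a) -> idflag N E ->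
  idflag N' (fun k i => h' i *m E k i *m h i).
Proof.
move=> hh' h'h Nh [chE rkE stE maxE].
have mulE i (A B : 'M[R]_(n i)) : h' i *m A *m h i *m (h' i *m B *m h i) =
    h' i *m (A *m B) *m h i.
  by rewrite !mulmxA -[_ *m h i *m h' i]mulmxA hh' mulmx1.
split.
- by move=> i j k jk; rewrite !mulE; case: (chE i j k jk) => -> ->.
- move=> L f k i; rewrite !map_mxM mxrankMfree ?eqmxMfull ?rkE //.
    rewrite row_full_unit; have := congr1 (map_mx f) (h'h i).
    by rewrite map_mxM map_mx1 => /mulmx1_unit [].
  rewrite row_free_unit; have := congr1 (map_mx f) (h'h i).
  by rewrite map_mxM map_mx1 => /mulmx1_unit [].
- move=> k a.
  have -> : h' (src a) *m E k (src a) *m h (src a) *m N' a =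
      h' (src a) *m (E k (src a) *m N a) *m h (tgt a) by rewrite -!mulmxA Nh.
  rewrite !mulmxA -[_ *m h (tgt a) *m h' _]mulmxA hh' mulmx1.
  by rewrite -!mulmxA; congr (_ *m _); rewrite !mulmxA stE.
- by move=> k i kn; rewrite maxE // mulmx1 h'h.
Qed.

Lemma std_idflag (R : comNzRingType) (Y : rep R) : std Y -> idflag Y (stdchain d R).
Proof.
move=> stdY; split.
- exact: chain_std.
- by move=> L f k i; rewrite (map_pid_mx f) -/(stdchain d L k i) rank_stdchain.
- move=> k a; exact: stdY.
- by move=> k i kn; rewrite /stdchain fdimn_max // pid_mx_1.
Qed.

End FlagProjections.

(** * Smoothness *)

Section SquareZero.
Variables (R S : comNzRingType) (f : {rmorphism R -> S}).
Hypothesis f_surj : forall s, exists r, f r = s.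
Hypothesis f_sq0 : forall a b, f a = 0 -> f b = 0 -> a * b = 0.

Lemma mulmx_sq0 (m n p : nat) (X : 'M[R]_(m, n)) (Y : 'M[R]_(n, p)) :
  map_mx f X = 0 -> map_mx f Y = 0 -> X *m Y = 0.
Proof.
move=> X0 Y0; apply/matrixP => i j; rewrite !mxE big1 // => k _; apply: f_sq0.
  by move/matrixP/(_ i k): X0; rewrite !mxE.
by move/matrixP/(_ k j): Y0; rewrite !mxE.
Qed.

Lemma lift_mx (m n : nat) (X : 'M[S]_(m, n)) : exists Y, map_mx f Y = X.
Proof.
have [s fs] := choice f_surj; exists (map_mx s X).
by apply/matrixP => i j; rewrite !mxE.
Qed.

(** Elements of the kernel square to zero, hence die in a domain. So ranks over [R] can be read off
    over [S]. *)
Lemma factor_sq0 (L : idomainType) (g : {rmorphism R -> L}) :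
  exists h : {rmorphism S -> L}, forall x, h (f x) = g x.
Proof.
have [s fs] := choice f_surj.
have gs x y : f x = f y -> g x = g y.
  move=> fxy; apply/eqP; rewrite -subr_eq0 -rmorphB -sqrf_eq0 -rmorphXn expr2.
  by rewrite f_sq0 ?rmorph0 // rmorphB fxy subrr.
have [|||h hE] := @rmorphism_of S L (fun x => g (s x)).
- by move=> x y; rewrite -rmorphD; apply: gs; rewrite rmorphD !fs.
- by move=> x y; rewrite -rmorphM; apply: gs; rewrite rmorphM !fs.
- by rewrite -(rmorph1 g); apply: gs; rewrite fs rmorph1.
by exists h => x; rewrite hE; apply: gs.
Qed.

(** This is [3 a^2 - 2 a^3], one Newton step towards a root of [a^2 - a]. *)
Definition idem_lift (n : nat) (a : 'M[R]_n) : 'M[R]_n :=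
  let z := a *m a - a in a + (z - a *m z - a *m z).

Lemma idem_liftP (n : nat) (a : 'M[R]_n) :
    map_mx f a *m map_mx f a = map_mx f a ->
  idem_lift a *m idem_lift a = idem_lift a /\ map_mx f (idem_lift a) = map_mx f a.
Proof.
move=> ida; rewrite /idem_lift; set z := a *m a - a; set w := a *m z.
have fz : map_mx f z = 0 by rewrite map_mxB map_mxM ida subrr.
have aa : a *m a = a + z by rewrite /z addrC subrK.
have az : a *m z = w by [].
have za : z *m a = w by rewrite /w /z mulmxBl mulmxBr mulmxA.
have zz : z *m z = 0 by apply: mulmx_sq0.
have aw : a *m w = w by rewrite /w mulmxA aa mulmxDl zz addr0.
have wa : w *m a = w by rewrite /w -mulmxA za.
have zw : z *m w = 0 by rewrite /w mulmxA za /w -mulmxA zz mulmx0.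
have wz : w *m z = 0 by rewrite /w -mulmxA zz mulmx0.
have ww : w *m w = 0 by rewrite {1}/w -mulmxA zw mulmx0.
have fw : map_mx f w = 0 by rewrite map_mxM fz mulmx0.
clearbody w; clearbody z.
split; last by rewrite map_mxD !map_mxB fz fw !subr0 addr0.
rewrite !(mulmxDl, mulmxDr, mulmxN, mulNmx) aa az za zz aw wa zw wz ww.
rewrite !(oppr0, addr0) subrr sub0r.
by rewrite !addrA.
Qed.

(** Idempotents are lifted from the top down; sandwiching a lift between two copies of the previous
    idempotent preserves the chain relations. *)
Lemma lift_chain (n nu : nat) (e : nat -> 'M[S]_n) :
    chain e -> (forall k, (nu <= k)%N -> e k = 1%:M) ->
  exists E : nat -> 'M[R]_n, [/\ chain E, forall k, map_mx f (E k) = e k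
    & forall k, (nu <= k)%N -> E k = 1%:M].
Proof.
move=> che e1; have /choice [l lP] k := lift_mx (e k).
pose P := nat_rect (fun=> 'M[R]_n) 1%:M
  (fun j X => idem_lift (X *m l (nu - j.+1)%N *m X)).
have PS j : P j.+1 = idem_lift (P j *m l (nu - j.+1)%N *m P j) by [].
have ee j k : (j <= k)%N -> e j *m e k = e j /\ e k *m e j = e j by apply: che.
have PP j : [/\ map_mx f (P j) = e (nu - j)%N, P j *m P j = P j,
   P j *m P j.+1 = P j.+1 & P j.+1 *m P j = P j.+1].
  (* [idem_lift a] is a polynomial in [a] without constant term, so absorption by [X] passes from
     [a] to it. *)
  have aux (X a : 'M[R]_n) : X *m a = a -> a *m X = a -> 
      X *m idem_lift a = idem_lift a /\ idem_lift a *m X = idem_lift a.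
    move=> Xa aX; rewrite /idem_lift !(mulmxDl, mulmxDr, mulmxN, mulNmx).
    by rewrite -!mulmxA !aX !mulmxA !Xa.
  have step : map_mx f (P j) = e (nu - j)%N -> P j *m P j = P j ->
      P j *m P j.+1 = P j.+1 /\ P j.+1 *m P j = P j.+1.
    by move=> _ idP; rewrite PS; apply: aux; rewrite ?mulmxA ?idP // -mulmxA idP.
  suff [fP idP] : map_mx f (P j) = e (nu - j)%N /\ P j *m P j = P j.
    by have [] := step fP idP; split.
  elim: j {step} => [|j [fP idP]]; first by rewrite /= map_mx1 mulmx1 subn0 e1.
  have fl : map_mx f (P j *m l (nu - j.+1)%N *m P j) = e (nu - j.+1)%N.
    have [el er] := ee _ _ (leq_sub2l nu (leqnSn j)).
    by rewrite !map_mxM fP lP er el.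
  have [] := @idem_liftP _ (P j *m l (nu - j.+1)%N *m P j).
    by rewrite fl; case: (ee _ _ (leqnn (nu - j.+1)%N)).
  by rewrite -PS fl.
have E1 k : (nu <= k)%N -> P (nu - k)%N = 1%:M by rewrite -subn_eq0 => /eqP ->.
exists (fun k => P (nu - k)%N); split=> //.
  apply: chain_step => k; first by case: (PP (nu - k)%N).
  have [nk|kn] := leqP nu k; first by rewrite !E1 ?leqW // mulmx1.
  by rewrite -subnSK //; case: (PP (nu - k.+1)%N).
move=> k; have [nk|kn] := leqP nu k; first by rewrite E1 // map_mx1 e1.
by have [-> _ _ _] := PP (nu - k)%N; rewrite subKn // ltnW.
Qed.

(* The Schur complement of the invertible block [1 + w] is [x] up to products
   of two elements of the kernel. *)
Lemma det_sq0 (r : nat) (x : 'M[R]_1) (u : 'M[R]_(1, r)) (v : 'M[R]_(r, 1))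
    (w : 'M[R]_r) :
    map_mx f x = 0 -> map_mx f u = 0 -> map_mx f v = 0 -> map_mx f w = 0 ->
  \det (block_mx x u v (1%:M + w)) = 0 -> x = 0.
Proof.
move=> x0 u0 v0 w0 det0.
have E : block_mx 1%:M (- u) 0 1%:M *m block_mx x u v (1%:M + w) =
    block_mx x 0 v (1%:M + w).
  rewrite mulmx_block !mul1mx !mul0mx !add0r !mulNmx mulmxDr mulmx1.
  by rewrite (mulmx_sq0 u0 v0) (mulmx_sq0 u0 w0) subr0 addr0 subrr.
have : \det (block_mx x 0 v (1%:M + w)) = 0 by rewrite -E det_mulmx det0 mulr0.
rewrite det_lblock => xw0.
have ww : (1%:M + w) *m (1%:M - w) = 1%:M.
  by rewrite mulmxBr mulmx1 mulmxDl mul1mx (mulmx_sq0 w0 w0) addr0 addrK.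
apply/matrixP => i j; rewrite !ord1 mxE -[x 0 0]det_mx11.
by rewrite -[\det x]mulr1 -(det1 R r) -ww det_mulmx mulrA xw0 mul0r.
Qed.

End SquareZero.

(** An invertible minor of maximal size in adapted bases, normalized to 1; such an identity survives
    any base change. *)
Lemma rank_two_sided_inverse (F : fieldType) (m n : nat) (A : 'M[F]_(m, n)) :
  exists (C : 'M_(\rank A, m)) (D : 'M_(n, \rank A)), C *m A *m D = 1%:M.
Proof.
exists (pid_mx (\rank A) *m invmx (col_ebase A)).
exists (invmx (row_ebase A) *m pid_mx (\rank A)).
rewrite -[X in _ *m X *m _](mulmx_ebase A) !mulmxA mulmxKV ?col_ebase_unit //.
rewrite mulmxK ?row_ebase_unit // pid_mx_id ?rank_leq_row //.
by rewrite pid_mx_id ?rank_leq_col // pid_mx_1.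
Qed.

(** A vector [v] killed by the cokernel is then [(v B) A]: an explicit preimage that remains valid
    after base change. *)
Lemma cokermx_split (F : fieldType) (m n : nat) (A : 'M[F]_(m, n)) :
  exists (B : 'M_(n, m)) (Z : 'M_n), B *m A + cokermx A *m Z = 1%:M.
Proof.
exists (invmx (row_ebase A) *m pid_mx (\rank A) *m invmx (col_ebase A)), (row_ebase A).
rewrite -[X in _ *m X + _](mulmx_ebase A) !mulmxA mulmxKV ?col_ebase_unit //.
rewrite /cokermx /copid_mx.
rewrite -(mulmxA (invmx (row_ebase A))) pid_mx_id ?rank_leq_row //.
by rewrite mulmxBr mulmxBl mulmx1 mulVmx ?row_ebase_unit // addrC subrK.
Qed.

Section MinorsSmooth.
Variables (K : closedFieldType) (Q : quiver) (nu : nat) (d : filtration Q nu).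
Local Notation n := (d ord_max).
Local Notation rep := (mrep n).
Local Notation gl := (mgl n).
Variable (M : repspace K n).
Hypothesis rank_std :
  forall Y : rep K, std Y -> (\rank (bracket_mx M Y) <= \rank (bracket_mx M M))%N.

(* [flag_minor] applied to the minors bordering an invertible one of
   [bracket_mx M M] by the identity of [M] and by a linear form vanishing on its
   image: to first order in [N - M] these are the linear forms themselves. *)
Lemma tangent_flag (R S : comNzRingType) (rho : {rmorphism K -> R})
    (f : {rmorphism R -> S}) (N : rep R) (E : nat -> gl R) :
    (forall a b, f a = 0 -> f b = 0 -> a * b = 0) ->
    map_fam f N = map_fam f (map_fam rho M) -> idflag N E ->
  exists phi : gl R, map_fam f phi = (fun i => 0) /\
    forall a, map_fam rho M a - N a =
      phi (src a) *m map_fam rho M a - map_fam rho M a *m phi (tgt a).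
Proof.
move=> f_sq0 fN flagN; pose A := bracket_mx M M.
pose MR := map_fam rho M; pose eps := flat (bracket MR N (fun i => 1%:M)).
have epsE : eps = flat (fun a => MR a - N a).
  rewrite /eps; congr flat; apply: functional_extensionality_dep => a.
  by rewrite /bracket mulmx1 mul1mx.
have feps : map_mx f eps = 0.
  rewrite epsE map_flat; apply/rowP => j; rewrite !mxE.
  have := congr1 (fun X : mrep n S => X (tag (enum_val j))) fN.
  rewrite /map_fam => /matrixP/(_ (tagged (enum_val j)).1 (tagged (enum_val j)).2).
  by rewrite !mxE rmorphB => ->; rewrite subrr.
have mapA : map_mx rho A = bracket_mx MR MR by rewrite map_bracket_mx.
have fB : map_mx f (bracket_mx MR N - map_mx rho A) = 0.
  by rewrite map_mxB mapA !map_bracket_mx fN subrr.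
have [C1 [D1 CAD]] := rank_two_sided_inverse A.
(* [c] is the identity family: [bracket_mx MR N] sends it to [eps], and [bracket_mx MR MR] to 0. *)
pose c : 'rV[R]_#|{: mentry n n}| := flat (fun i : vert Q => 1%:M : 'M[R]_(n i)).
have cB : c *m bracket_mx MR N = eps by rewrite mul_flat_bracket_mx.
have cA : c *m map_mx rho A = 0.
  rewrite mapA mul_flat_bracket_mx (_ : bracket _ _ _ = (fun a => 0)).
    by apply/rowP => j; rewrite !mxE.
  by apply: functional_extensionality_dep => a; rewrite /bracket mulmx1 mul1mx subrr.
(* The bordering row and column contribute only zeros to the product with [A], whose minor is 1. The
   minor of [bracket_mx MR N] thus has the block form of [det_sq0], with corner [eps l]. *)
have lin (l : 'cV[K]_#|{: mentry (fun a : arr Q => n (src a)) (fun a => n (tgt a))}|) :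
    A *m l = 0 -> eps *m map_mx rho l = 0.
  move=> Al; pose C : 'M[R]_(1 + \rank A, _) := col_mx c (map_mx rho C1).
  pose D : 'M[R]_(_, 1 + \rank A) := row_mx (map_mx rho l) (map_mx rho D1).
  have : \det (C *m bracket_mx MR N *m D) = 0 := flag_minor rank_std rho C D flagN.
  rewrite -[bracket_mx MR N](subrK (map_mx rho A)) mulmxDr mulmxDl.
  set T := bracket_mx MR N - map_mx rho A in fB *.
  rewrite /C /D !mul_col_mx !mul_mx_row -!/(block_mx _ _ _ _) cA !mul0mx.
  rewrite -!map_mxM -!mulmxA Al !mulmx0.
  rewrite [C1 *m _]mulmxA CAD map_mx0 map_mx1 add_block_mx !addr0 [_ + 1%:M]addrC.
  move/(det_sq0 f_sq0) => x0; rewrite -cB -[bracket_mx MR N](subrK (map_mx rho A)) -/T.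
  rewrite mulmxDr cA addr0 -mulmxA; apply: x0; rewrite !map_mxM fB ?mul0mx ?mulmx0 //.
have [B [Z BZ]] := cokermx_split A.
have epsC : eps *m map_mx rho (cokermx A) = 0.
  apply/matrixP => i j; have Al : A *m col j (cokermx A) = 0.
    by rewrite colE mulmxA mulmx_coker mul0mx.
  by have /matrixP/(_ i 0) := lin _ Al; rewrite map_col colE mulmxA -colE !mxE.
pose phi : gl R := unflat (eps *m map_mx rho B).
exists phi; split.
  rewrite map_unflat map_mxM feps mul0mx; apply: functional_extensionality_dep => i.
  by apply/matrixP => p q; rewrite !mxE.
have : flat (fun a => MR a - N a) = flat (bracket MR MR phi).
  rewrite -mul_flat_bracket_mx unflatK -mapA -epsE -mulmxA -map_mxM.
  rewrite -[LHS]mulmx1 -(map_mx1 rho) -BZ map_mxD mulmxDr.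
  rewrite [map_mx rho (cokermx A *m Z)]map_mxM.
  by rewrite [in X in _ + X]mulmxA epsC mul0mx addr0.
by move=> /(congr1 (@unflat _ _ _ R)); rewrite !flatK => e a;
  rewrite -/MR (congr1 (fun X : mrep n R => X a) e).
Qed.

End MinorsSmooth.

Section SmoothFl.
Variables (K : closedFieldType) (Q : quiver) (nu : nat) (d : filtration Q nu).
Local Notation n := (d ord_max).
Local Notation rep := (mrep n).
Local Notation gl := (mgl n).
Variable (M : repspace K n).
Hypothesis rank_std :
  forall Y : rep K, std Y -> (\rank (bracket_mx M Y) <= \rank (bracket_mx M M))%N.

Lemma smooth_Fl : smooth (Fl M).
Proof.
move=> R S f f_surj f_sq0 [U HU].
pose rho : {rmorphism K -> R} := in_alg R; pose MR := map_fam rho M.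
have fMR : map_fam f MR = map_fam (in_alg S) M.
  apply: functional_extensionality_dep => a; apply/matrixP => p q.
  by rewrite !mxE /= rmorph_alg.
have [e [[che rke ste maxe] Ue]] := idflag_of_flag HU.
have exE i : exists E : nat -> 'M[R]_(n i), [/\ chain E,
    forall k, map_mx f (E k) = e k i & forall k, (nu <= k)%N -> E k = 1%:M].
  exact: (lift_chain f_surj f_sq0 (che i) (fun k => @maxe k i)).
pose E (k : nat) : gl R := fun i => projT1 (cid (exE i)) k.
have [chE fE maxE] : [/\ forall i, chain (fun k => E k i),
    forall k i, map_mx f (E k i) = e k i & forall k i, (nu <= k)%N -> E k i = 1%:M].
  by split=> [i|k i|k i]; rewrite /E; case: (cid (exE i)) => E' [] /= c1 c2 c3;
    [exact: c1|exact: c2|exact: c3].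
clearbody E; clear exE.
(* Each graded piece is moved by [M] and then projected into the member of the flag of its own
   index. So [N] preserves [E], and it reduces to [M] because [e] is stable over [S]. *)
pose N : rep R := fun a =>
  \sum_(j < nu.+1) gr (fun k => E k (src a)) j *m MR a *m E j (tgt a).
have rkE (L : fieldType) (g : {rmorphism R -> L}) k i :
    \rank (map_mx g (E k i)) = fdimn d k i.
  have [h hf] := factor_sq0 f_surj f_sq0 g; rewrite -(rke L h k i) -fE -map_mx_comp.
  by congr (\rank _); apply/matrixP => p q; rewrite !mxE /= hf.
have stN k a : E k (src a) *m N a *m E k (tgt a) = E k (src a) *m N a.
  rewrite /N mulmx_sumr mulmx_suml; apply: eq_bigr => j _.
  rewrite !mulmxA gr_mull //; case: ifP => jk; last by rewrite !mul0mx.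
  by rewrite -!mulmxA (chE (tgt a) _ _ jk).1.
have fN : map_fam f N = map_fam f MR.
  rewrite fMR; apply: functional_extensionality_dep => a; rewrite /map_fam /N map_mx_sum.
  transitivity (\sum_(j < nu.+1) gr (fun k => e k (src a)) j *m map_mx (in_alg S) (M a)).
    apply: eq_bigr => j _; rewrite !map_mxM map_gr fE.
    have -> : map_mx f (MR a) = map_mx (in_alg S) (M a).
      by rewrite -[RHS]/(map_fam _ M a) -fMR.
    have -> : gr (fun k => map_mx f (E k (src a))) j = gr (fun k => e k (src a)) j.
      by congr gr; apply: funext => k; rewrite fE.
    have eg : gr (fun k => e k (src a)) j *m e j (src a) = gr (fun k => e k (src a)) j.
      by rewrite (gr_mulr (che (src a))) leqnn.
    have := ste j a; rewrite /map_fam => st.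
    by rewrite -eg -!mulmxA [e j (src a) *m (_ *m _)]mulmxA st.
  by rewrite -mulmx_suml gr_sum // maxe // mul1mx.
have flagN : idflag N E by split.
have [phi [fphi MN]] := tangent_flag rank_std f_sq0 fN flagN.
have fphi0 i : map_mx f (phi i) = 0 by rewrite -[LHS]/(map_fam f phi i) fphi.
have phi2 i : phi i *m phi i = 0 by apply: mulmx_sq0 f_sq0 _ _ _ _ _ _ _.
(* These are mutually inverse since [phi] squares to zero; to first order, conjugation by them
   cancels the difference of [N] and [MR]. *)
pose h i := 1%:M - phi i; pose h' i := 1%:M + phi i.
have hh' i : h i *m h' i = 1%:M.
  by rewrite /h /h' mulmxDr mulmx1 mulmxBl mul1mx phi2 subr0 subrK.
have h'h i : h' i *m h i = 1%:M by apply: mulmx1C.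
have Nh a : N a *m h (tgt a) = h (src a) *m MR a.
  rewrite /h mulmxBr mulmx1 mulmxBl mul1mx.
  have NE : N a = MR a - phi (src a) *m MR a + MR a *m phi (tgt a).
    by rewrite -[LHS](subKr (MR a)) MN opprB addrA addrAC.
  rewrite [in X in _ - X]NE !mulmxDl mulNmx -!mulmxA phi2 mulmx0 addr0.
  rewrite [phi _ *m (_ *m _)](mulmx_sq0 f_sq0) ?map_mxM ?fphi0 ?mulmx0 // oppr0 addr0.
  by rewrite NE addrK.
have flagM := conj_idflag hh' h'h Nh flagN.
exists (exist _ _ (flag_of_idflag flagM)); apply: flag_eq => k i /=.
have fE' : map_mx f (h' i *m E k i *m h i) = e k i.
  by rewrite !map_mxM fE /h' /h map_mxD map_mxB fphi0 addr0 subr0 map_mx1 mul1mx mulmx1.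
have idE' : h' i *m E k i *m h i *m (h' i *m E k i *m h i) = h' i *m E k i *m h i.
  by case: (idflag_chain flagM i (leqnn k)).
apply/seteqP; split=> v.
  by move=> /(base_change_im f idE' (fun=> iff_refl _)); rewrite fE' => /Ue.
by move=> /Ue; rewrite -fE' => /(base_change_im f idE' (fun=> iff_refl _)).
Qed.
End SmoothFl.

(** * Irreducibility *)

Section KernelFamily.
Variables (K : closedFieldType) (Q : quiver) (nu : nat) (d : filtration Q nu).
Local Notation n := (d ord_max).
Local Notation rep := (mrep n).
Local Notation gl := (mgl n).
Local Notation dR := #|{: mentry (fun a : arr Q => n (src a)) (fun a => n (tgt a))}|.
Local Notation dG := #|{: mentry n n}|.
Variable (M : repspace K n).

(* Cramer's rule: the point of the kernel of [A] cut out by the minor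
   [C *m A *m D] and the parameter [v]. *)
Definition cramer (R : comNzRingType) (p q r : nat) (A : 'M[R]_(p, q))
    (C : 'M[R]_(r, p)) (D : 'M[R]_(q, r)) (v : 'rV[R]_p) : 'rV[R]_p :=
  \det (C *m A *m D) *: v - v *m A *m D *m \adj (C *m A *m D) *m C.

Lemma map_cramer (R S : comNzRingType) (f : {rmorphism R -> S}) p q r
    (A : 'M[R]_(p, q)) (C : 'M[R]_(r, p)) (D : 'M[R]_(q, r)) (v : 'rV[R]_p) :
  map_mx f (cramer A C D v) =
  cramer (map_mx f A) (map_mx f C) (map_mx f D) (map_mx f v).
Proof.
by rewrite /cramer map_mxB map_mxZ -det_map_mx !map_mxM map_mx_adj !map_mxM.
Qed.

(** Entry [j] of the product is the Schur complement of [W] in the minor bordered by [v] and the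
    [j]-th basis column. Its product with [det W] vanishes, and the ring is a domain. *)
Lemma cramer_kernel (R : idomainType) (p q r : nat) (A : 'M[R]_(p, q))
    (C : 'M[R]_(r, p)) (D : 'M[R]_(q, r)) (v : 'rV[R]_p) :
    (forall (C' : 'M[R]_(r.+1, p)) (D' : 'M[R]_(q, r.+1)), \det (C' *m A *m D') = 0) ->
    \det (C *m A *m D) != 0 -> cramer A C D v *m A = 0.
Proof.
rewrite /cramer => minors0 W0; set W := C *m A *m D in W0 *.
apply/rowP => j; rewrite [RHS]mxE.
pose l : 'cV[R]_q := delta_mx j 0.
have det0 : \det (col_mx v C *m A *m row_mx l D) = 0 := minors0 (col_mx v C) (row_mx l D).
rewrite !mul_col_mx !mul_mx_row -/(block_mx _ _ _ _) -/W in det0.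
pose e := \det W *: (v *m A *m l) - v *m A *m D *m \adj W *m (C *m A *m l).
have E : block_mx (v *m A *m l) (v *m A *m D) (C *m A *m l) W *m
      block_mx (\det W)%:M 0 (- (\adj W *m (C *m A *m l))) 1%:M =
    block_mx e (v *m A *m D) 0 W.
  rewrite mulmx_block !mulmx0 !mulmx1 !add0r !mulmxN !mul_mx_scalar.
  by rewrite [W *m _]mulmxA mul_mx_adj mul_scalar_mx subrr [_ *m (\adj W *m _)]mulmxA.
have : e 0 0 * \det W = 0.
  rewrite -[e 0 0]det_mx11; have := congr1 determinant E.
  by rewrite det_mulmx det0 mul0r det_ublock => <-.
move/eqP; rewrite mulf_eq0 (negbTE W0) orbF => /eqP e0.
rewrite -[RHS]e0 /e -[LHS]/((_ *m A) 0 j).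
have -> (X : 'rV[R]_q) : X 0 j = (X *m l) 0 0 by rewrite -colE mxE.
by congr (fun_of_matrix _ 0 0); rewrite !mulmxBl -!scalemxAl -!mulmxA.
Qed.

(* Every [F]-point of the flag variety is [std] moved by some [G] over [F], and
   [G] is a Cramer point of the kernel of [bracket_mx M Y] for [Y = G M G^-1]. *)
Lemma flag_cramer (F : fieldType) (sigma : {rmorphism K -> F}) (E : nat -> gl F) :
    idflag (map_fam sigma M) E ->
  exists (Y : rep F) (C : 'M[F]_(\rank (bracket_mx M M), dG))
      (D : 'M[F]_(dR, \rank (bracket_mx M M))) (G G' : gl F),
    [/\ std Y, C *m bracket_mx (map_fam sigma M) Y *m D = 1%:M,
        cramer (bracket_mx (map_fam sigma M) Y) C D (flat G) = flat G,
        forall i, G i *m G' i = 1%:M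
      & forall (k : 'I_nu.+1) i, E k i = G' i *m stdchain d F k i *m G i].
Proof.
move=> flagE; have [chE rkE stE maxE] := flagE.
have exG i : exists G, G \in unitmx /\
    forall k, (k <= nu)%N -> G *m E k i = stdchain d F k i *m G.
  apply: conj_chain; [exact: chE|exact: chain_std| |exact: maxE].
  by move=> k; rewrite rank_stdchain -(rkE F idfun) map_mx_id.
pose G : gl F := fun i => projT1 (cid (exG i)).
have GU i : G i \in unitmx by rewrite /G; case: (cid _) => ? [].
have GE k i : (k <= nu)%N -> G i *m E k i = stdchain d F k i *m G i.
  by rewrite /G; case: (cid _) => ? [? +]; apply.
clearbody G; pose G' : gl F := fun i => invmx (G i).
have GG' i : G i *m G' i = 1%:M by rewrite mulmxV.
have G'G i : G' i *m G i = 1%:M by rewrite mulVmx.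
pose MF := map_fam sigma M.
pose Y : rep F := fun a => G (src a) *m MF a *m G' (tgt a).
have YG a : Y a *m G (tgt a) = G (src a) *m MF a by rewrite /Y -mulmxA G'G mulmx1.
have [LG [LH conjE]] : exists (LG : 'M[F]_dG) (LH : 'M[F]_dR),
    LG *m bracket_mx MF Y *m LH = bracket_mx MF MF.
  have [LG [LH]] := @bracket_conj _ _ _ MF MF Y G G' 1 1
    (fun a => etrans (YG a) (esym (scale1r _))) G'G.
  have -> : (fun a => 1 *: MF a) = MF.
    by apply: functional_extensionality_dep => a; rewrite scale1r.
  by rewrite mulr1 scale1r => conjE; exists LG, LH.
have [C1 [D1 CAD]] := rank_two_sided_inverse (bracket_mx M M).
have WE : map_mx sigma C1 *m LG *m bracket_mx MF Y *m (LH *m map_mx sigma D1) = 1%:M.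
  rewrite !mulmxA -[_ *m LG *m _]mulmxA -[_ *m _ *m LH]mulmxA conjE.
  by rewrite -map_bracket_mx -!map_mxM CAD map_mx1.
exists Y, (map_mx sigma C1 *m LG), (LH *m map_mx sigma D1), G, G'; split=> //.
- have flagY : idflag Y (fun k i => G i *m E k i *m G' i).
    apply: conj_idflag flagE => // a.
    by rewrite /Y !mulmxA G'G mul1mx.
  have stdE k i : (k <= nu)%N -> G i *m E k i *m G' i = stdchain d F k i.
    by move=> kn; rewrite GE // -mulmxA GG' mulmx1.
  move=> k a; have kn : (k <= nu)%N by rewrite -ltnS.
  by have := idflag_stab flagY k a; rewrite /= !stdE // !stdchainE.
- rewrite /cramer WE det1 scale1r mul_flat_bracket_mx.
  have -> : bracket MF Y G = (fun a => 0).
    by apply: functional_extensionality_dep => a; rewrite /bracket YG subrr.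
  have -> : flat (fun a : arr Q => 0 : 'M[F]_(n (src a), n (tgt a))) = 0.
    by apply/rowP => j; rewrite !mxE.
  by rewrite !mul0mx subr0.
- by move=> k i; rewrite -mulmxA -GE ?mulmxA ?G'G ?mul1mx // -ltnS.
Qed.

End KernelFamily.

(** A point is restricted to a residue field of its ring. The unit-ideal relation witnessing
    membership in [U] is carried along. *)
Lemma field_point (K : closedFieldType) (X : kfunctor K) (U : subfunctor X) :
    open_subfunctor U -> nonempty_subfunctor U ->
  exists (F : fieldType) (sigma : {rmorphism K -> F}) (x : X (alg_via sigma)),
    U (alg_via sigma) x.
Proof.
move=> openU [R [x Ux]].
have [|y z -> ->|a y ->|/eqP|F [f [_ _]]] := @residue_field R [set 0].
- by [].
- by rewrite /= subrr.
- by rewrite /= mulr0.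
- by rewrite oner_eq0.
pose sigma : {rmorphism K -> F} := f \o in_alg R.
have [g gE] := @lrmorphism_of K R (alg_via sigma) f (fun a => esym (in_alg_via sigma a)).
exists F, sigma, (Defs.pmap g x).
have [J JP] := openU R x; apply/JP.
have /JP [m [a [s [Ja s1]]]] : U R (Defs.pmap idfun x) by rewrite Defs.pmap_id.
exists m, a, (fun j => g (s j)); split=> //.
rewrite -(rmorph1 g) -s1 raddf_sum; apply: eq_bigr => j _.
exact: esym (rmorphM g _ _).
Qed.

Section GenericFlag.
Variables (K : closedFieldType) (Q : quiver) (nu : nat) (d : filtration Q nu).
Local Notation n := (d ord_max).
Local Notation rep := (mrep n).
Local Notation gl := (mgl n).
Variable (M : repspace K n).

Lemma map_in_alg_via (R : comNzRingType) (sigma : {rmorphism K -> R}) :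
  map_fam (in_alg (alg_via sigma)) M = map_fam sigma M.
Proof.
apply: functional_extensionality_dep => a; apply/matrixP => p q; rewrite !mxE.
exact: in_alg_via.
Qed.

Variables (A : idomainType) (rho : {rmorphism K -> A}) (Y : rep A) (h : gl A).

Definition prod_det : A := \prod_i \det (h i).

Lemma prod_det_specialize (F : comNzRingType) (psi : {rmorphism A -> F}) (G' : gl F) :
    (forall i, map_mx psi (h i) *m G' i = 1%:M) ->
  psi prod_det * \prod_i \det (G' i) = 1.
Proof.
move=> hG'; rewrite /prod_det rmorph_prod -big_split /= big1 // => i _.
by rewrite -det_map_mx -det_mulmx hG' det1.
Qed.

Lemma prod_det_inv (B : comNzRingType) (iota : {rmorphism A -> B}) (u : B) :
    iota prod_det * u = 1 ->
  exists2 h' : gl B, forall i, map_mx iota (h i) *m h' i = 1%:M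
    & forall i, h' i *m map_mx iota (h i) = 1%:M.
Proof.
move=> uD; have [H [hH Hh]] := gl_adjugate (map_fam iota h).
have uE : u * \prod_j \det (map_fam iota h j) = 1.
  rewrite mulrC -[RHS]uD /prod_det rmorph_prod; congr (_ * _).
  by apply: eq_bigr => j _; rewrite -det_map_mx.
by exists (fun i => u *: H i) => i;
  rewrite -?scalemxAr -?scalemxAl (hH, Hh) scale_scalar_mx uE.
Qed.


(** Inverting all [det (h i)] makes [h] an isomorphism carrying the coordinate flag to a flag of
    [M]. A specialization at which [h] is invertible factors through this localization. *)
Lemma generic_flag :
    prod_det != 0 -> std Y ->
    (forall a, Y a *m h (tgt a) = h (src a) *m map_fam rho M a) ->
  exists (iota : {rmorphism A -> loc prod_det}) (z : Fl M (alg_via (iota \o rho))),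
    (forall a, val (iota a) = tofrac a) /\
    forall (F : comNzRingType) (sigma : {rmorphism K -> F}) (psi : {rmorphism A -> F})
      (G' : gl F) (x : Fl M (alg_via sigma)),
    (forall a, psi (rho a) = sigma a) ->
    (forall i, map_mx psi (h i) *m G' i = 1%:M) ->
    (forall (k : 'I_nu.+1) i v, proj1_sig x k i v <->
       v *m (G' i *m stdchain d F k i *m map_mx psi (h i)) = v) ->
  exists g : {lrmorphism alg_via (iota \o rho) -> alg_via sigma}, Defs.pmap g z = x.
Proof.
move=> D0 stdY hM; have [iota iotaE] := loc_embed prod_det.
have [u uD] := loc_inv D0 iotaE; have [h' hh' h'h] := prod_det_inv uD.
pose rhoB : {rmorphism K -> loc prod_det} := iota \o rho.
have hMB a : map_fam iota Y a *m map_fam iota h (tgt a) =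
    map_fam iota h (src a) *m map_fam rhoB M a.
  rewrite /map_fam -map_mxM hM map_mxM; congr (_ *m _).
  by apply/matrixP => p q; rewrite !mxE.
pose AB : comAlgType K := alg_via rhoB.
have flagB : @idflag Q nu d AB (map_fam (in_alg AB) M)
    (fun k i => h' i *m stdchain d AB k i *m map_mx iota (h i)).
  rewrite map_in_alg_via.
  exact: (conj_idflag hh' h'h hMB (std_idflag (map_std iota stdY))).
exists iota, (exist _ _ (flag_of_idflag flagB)); split=> // F sigma psi G' x psiK hG' xE.
have [psi' psi'E] := loc_extend iotaE (prod_det_specialize hG').
have psi'K a : psi' (in_alg (alg_via rhoB) a) = in_alg (alg_via sigma) a.
  by rewrite !in_alg_via -psiK -psi'E.
have [g gE] := @lrmorphism_of K (alg_via rhoB) (alg_via sigma) psi' psi'K.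
exists g; apply: flag_eq => k i /=.
have gh : map_mx g (map_mx iota (h i)) = map_mx psi (h i).
  by apply/matrixP => p q; rewrite !mxE gE psi'E.
have gh' : map_mx g (h' i) = G' i.
  have e : map_mx g (h' i) *m map_mx psi (h i) = 1%:M.
    by rewrite -gh -map_mxM h'h map_mx1.
  by rewrite -[LHS]mulmx1 -(hG' i) mulmxA e mul1mx.
set E := h' i *m _ *m _.
have gE' : map_mx g E = G' i *m stdchain d F k i *m map_mx psi (h i).
  by rewrite /E !map_mxM gh gh' (map_pid_mx g).
have idE : E *m E = E by case: (idflag_chain flagB i (leqnn k)).
apply/seteqP; split=> v.
  by move=> /(base_change_im g idE (fun=> iff_refl _)); rewrite gE' => /xE.
by move=> /xE; rewrite -gE' => /(base_change_im g idE (fun=> iff_refl _)).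
Qed.

(* Two open subfunctors containing specializations of the generic flag both
   contain its restriction to the fraction field. *)
Lemma generic_point (iota : {rmorphism A -> loc prod_det})
    (z : Fl M (alg_via (iota \o rho))) : (forall a, val (iota a) = tofrac a) ->
  exists (S : comAlgType K) (y : Fl M S),
    forall (W : subfunctor (Fl M)) (T : comAlgType K)
      (g : {lrmorphism alg_via (iota \o rho) -> T}),
    open_subfunctor W -> W T (Defs.pmap g z) -> W S y.
Proof.
move=> iotaE; pose frac : {rmorphism loc prod_det -> {fraction A}} := val.
pose rhoF : {rmorphism K -> {fraction A}} := frac \o (iota \o rho).
have [j jE] : exists j : {lrmorphism alg_via (iota \o rho) -> alg_via rhoF}, j =1 frac.
  by apply: lrmorphism_of => a; rewrite !in_alg_via.
exists (alg_via rhoF), (Defs.pmap j z) => W T g openW Wz.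
have [J JP] := openW _ z; have /JP [m [a [s [Ja s1]]]] := Wz.
(* The images of the [a i] generate the unit ideal, so one [a i] is nonzero and becomes a unit in
   the fraction field. *)
have [i ai] : exists i, a i != 0.
  apply/existsP; apply: contraT; rewrite negb_exists => /forallP a0.
  have /eqP := s1; rewrite big1 ?(eq_sym 0) ?oner_eq0 // => i _.
  by have := a0 i; rewrite negbK => /eqP ->; rewrite rmorph0 mulr0.
apply/JP; exists 1%N, (fun=> a i), (fun=> (j (a i) : {fraction A})^-1).
split=> //; rewrite big_ord1 jE; apply: (@mulVf {fraction A}).
by apply: contra_neq ai => ai0; apply: val_inj.
Qed.

End GenericFlag.

Section Irreducible.
Variables (K : closedFieldType) (Q : quiver) (nu : nat) (d : filtration Q nu).
Local Notation n := (d ord_max).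
Local Notation rep := (mrep n).
Local Notation gl := (mgl n).
Local Notation dR := #|{: mentry (fun a : arr Q => n (src a)) (fun a => n (tgt a))}|.
Local Notation dG := #|{: mentry n n}|.
Variable (M : repspace K n).
Hypothesis rank_std :
  forall Y : rep K, std Y -> (\rank (bracket_mx M Y) <= \rank (bracket_mx M M))%N.
Local Notation r := (\rank (bracket_mx M M)).
Local Notation N := (dR + (r * dG + (dR * r + dG)))%N.

(* The affine space of data [(Y, C, D, v)] to which [cramer] is applied. *)
Definition dataY (R : comNzRingType) (x : 'rV[R]_N) : rep R :=
  stdproj (unflat (lsubmx x) : rep R).
Definition dataC (R : comNzRingType) (x : 'rV[R]_N) : 'M[R]_(r, dG) :=
  vec_mx (lsubmx (rsubmx x)).
Definition dataD (R : comNzRingType) (x : 'rV[R]_N) : 'M[R]_(dR, r) :=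
  vec_mx (lsubmx (rsubmx (rsubmx x))).
Definition datav (R : comNzRingType) (x : 'rV[R]_N) : 'rV[R]_dG :=
  rsubmx (rsubmx (rsubmx x)).
Definition datah (R : comNzRingType) (rho : {rmorphism K -> R}) (x : 'rV[R]_N) : gl R :=
  unflat (cramer (bracket_mx (map_fam rho M) (dataY x)) (dataC x) (dataD x) (datav x)).

Lemma map_datah (R S : comNzRingType) (rho : {rmorphism K -> R})
    (sigma : {rmorphism K -> S}) (f : {rmorphism R -> S}) (x : 'rV[R]_N) :
    (forall a, f (rho a) = sigma a) ->
  map_fam f (datah rho x) = datah sigma (map_mx f x).
Proof.
move=> fE; rewrite /datah map_unflat map_cramer map_bracket_mx.
have -> : map_fam f (map_fam rho M) = map_fam sigma M.
  apply: functional_extensionality_dep => a; apply/matrixP => p q.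
  by rewrite !mxE fE.
rewrite /dataY /dataC /dataD /datav map_stdproj map_unflat !map_vec_mx.
by rewrite !map_lsubmx !map_rsubmx.
Qed.

Local Notation B0 := {mpoly K[N]}.
Local Notation rho0 := (@mpolyC N K : {rmorphism K -> B0}).
Definition gen : 'rV[B0]_N := \row_i 'X_i.
Definition genh : gl B0 := datah rho0 gen.

(** Evaluate at the data supplied by [flag_cramer]: there Cramer's formula returns [G] itself. *)
Lemma gen_specialize (F : fieldType) (sigma : {rmorphism K -> F}) (E : nat -> gl F) :
    idflag (map_fam sigma M) E ->
  exists (psi : {rmorphism B0 -> F}) (G' : gl F),
    [/\ forall a, psi (rho0 a) = sigma a,
        psi (\det (dataC gen *m bracket_mx (map_fam rho0 M) (dataY gen) *m
          dataD gen)) = 1,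
        forall i, map_mx psi (genh i) *m G' i = 1%:M
      & forall (k : 'I_nu.+1) i,
          E k i = G' i *m stdchain d F k i *m map_mx psi (genh i)].
Proof.
move=> /flag_cramer [Y [C [D [G [G' [stdY WE cE GG' EE]]]]]].
pose x : 'rV[F]_N := row_mx (flat Y) (row_mx (mxvec C) (row_mx (mxvec D) (flat G))).
pose psi : {rmorphism B0 -> F} := mmap sigma (x 0).
have psi0 a : psi (rho0 a) = sigma a by rewrite /psi /= mmapC.
have psix : map_mx psi gen = x.
  by apply/rowP => i; rewrite mxE [gen 0 i]mxE /= mmapX mmap1U.
have xY : dataY x = Y by rewrite /dataY /x row_mxKl flatK stdproj_id.
have xC : dataC x = C by rewrite /dataC /x row_mxKr row_mxKl mxvecK.
have xD : dataD x = D by rewrite /dataD /x !row_mxKr row_mxKl mxvecK.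
have xv : datav x = flat G by rewrite /datav /x !row_mxKr.
have psih i : map_mx psi (genh i) = G i.
  rewrite -[LHS]/(map_fam psi genh i) /genh (map_datah _ psi0) psix /datah.
  by rewrite xY xC xD xv cE flatK.
exists psi, G'; split=> //.
- rewrite -det_map_mx !map_mxM map_bracket_mx.
  have -> : map_fam psi (map_fam rho0 M) = map_fam sigma M.
    apply: functional_extensionality_dep => a; apply/matrixP => p q.
    by rewrite !mxE psi0.
  have -> : map_fam psi (dataY gen) = Y.
    rewrite -xY -psix /dataY map_stdproj map_unflat map_lsubmx.
    by [].
  have -> : map_mx psi (dataC gen) = C.
    by rewrite -xC -psix /dataC map_vec_mx map_lsubmx map_rsubmx.
  have -> : map_mx psi (dataD gen) = D.
    by rewrite -xD -psix /dataD map_vec_mx map_lsubmx !map_rsubmx.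
  by rewrite WE det1.
- by move=> i; rewrite psih.
- by move=> k i; rewrite psih.
Qed.

(** [std_minor] with scalar 1 kills the minors of size [r + 1] over the polynomial ring, a domain,
    so [cramer_kernel] applies. *)
Lemma genh_comm :
    \det (dataC gen *m bracket_mx (map_fam rho0 M) (dataY gen) *m dataD gen) != 0 ->
  forall a, dataY gen a *m genh (tgt a) = genh (src a) *m map_fam rho0 M a.
Proof.
move=> W0 a.
have : flat genh *m bracket_mx (map_fam rho0 M) (dataY gen) = 0.
  rewrite /genh /datah unflatK; apply: cramer_kernel => // C D.
  have := std_minor rank_std rho0 1 C D (stdproj_std (unflat (lsubmx gen) : rep B0)).
  have -> : (fun a => 1 *: map_fam rho0 M a) = map_fam rho0 M.
    by apply: functional_extensionality_dep => b; rewrite scale1r.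
  by rewrite mul1r.
rewrite mul_flat_bracket_mx => /(congr1 (@unflat _ _ _ B0)); rewrite flatK.
move=> /(congr1 (fun X : mrep n B0 => X a)) /= h0.
apply/eqP; rewrite eq_sym -subr_eq0; apply/eqP; rewrite -[LHS]/(bracket _ _ genh a) h0.
by apply/matrixP => p q; rewrite !mxE.
Qed.

(** A parametrization with the polynomial ring hidden. That [W] is nonzero will only follow from the
    existence of a specialization. *)
Lemma generic_intertwiner :
  exists (A : idomainType) (rho : {rmorphism K -> A}) (Y : rep A) (h : gl A) (W : A),
  [/\ std Y,
      W != 0 -> forall a, Y a *m h (tgt a) = h (src a) *m map_fam rho M a
    & forall (F : fieldType) (sigma : {rmorphism K -> F}) (E : nat -> gl F),
        idflag (map_fam sigma M) E ->
      exists (psi : {rmorphism A -> F}) (G' : gl F),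
        [/\ forall a, psi (rho a) = sigma a, psi W = 1,
            forall i, map_mx psi (h i) *m G' i = 1%:M
          & forall (k : 'I_nu.+1) i,
              E k i = G' i *m stdchain d F k i *m map_mx psi (h i)]].
Proof.
exists B0, rho0, (dataY gen), genh, (\det (dataC gen *m
  bracket_mx (map_fam rho0 M) (dataY gen) *m dataD gen)).
by split; [exact: stdproj_std|exact: genh_comm|exact: gen_specialize].
Qed.

(** Each nonempty open subfunctor has a field-valued point, which specializes one generic flag;
    hence both contain the same generic point. *)
Lemma irreducible_Fl : nonempty_functor (Fl M) -> irreducible (Fl M).
Proof.
move=> ne; split=> // U V openU openV neU neV.
have [A [rho [Y [h [W [stdY Yh hP]]]]]] := generic_intertwiner.
have spec (X : subfunctor (Fl M)) : open_subfunctor X -> nonempty_subfunctor X ->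
    exists (F : fieldType) (sigma : {rmorphism K -> F}) (x : Fl M (alg_via sigma))
      (psi : {rmorphism A -> F}) (G' : gl F),
    [/\ X _ x, forall a, psi (rho a) = sigma a, psi W = 1,
      forall i, map_mx psi (h i) *m G' i = 1%:M
    & forall (k : 'I_nu.+1) i v, proj1_sig x k i v <->
       v *m (G' i *m stdchain d F k i *m map_mx psi (h i)) = v].
  move=> openX neX; have [F [sigma [x Xx]]] := field_point openX neX.
  have [E [flagE xE]] := idflag_of_flag (proj2_sig x).
  rewrite map_in_alg_via in flagE.
  have [psi [G' [psiK W1 hG' EE]]] := hP _ _ _ flagE.
  by exists F, sigma, x, psi, G'; split=> // k i v; rewrite xE EE.
have [F1 [sigma1 [x1 [psi1 [G1 [Ux1 psi1K W1 hG1 x1E]]]]]] := spec U openU neU.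
have [F2 [sigma2 [x2 [psi2 [G2 [Vx2 psi2K _ hG2 x2E]]]]]] := spec V openV neV.
have W0 : W != 0.
  by apply: contra_neq (oner_neq0 F1) => W0; rewrite -W1 W0 rmorph0.
have D0 : prod_det h != 0.
  apply: contra_neq (oner_neq0 F1) => D0.
  by rewrite -(prod_det_specialize hG1) D0 rmorph0 mul0r.
have [iota [z [iotaE zP]]] := generic_flag D0 stdY (Yh W0).
have [S [y yP]] := generic_point z iotaE.
have [g1 g1z] := zP _ _ _ _ _ psi1K hG1 x1E.
have [g2 g2z] := zP _ _ _ _ _ psi2K hG2 x2E.
by exists S, y; split; [apply: (yP U _ g1)|apply: (yP V _ g2)]; rewrite ?g1z ?g2z.
Qed.

End Irreducible.

(** * The dimension of Ext^1 *)

Lemma linear_of (R : nzRingType) (U V : lmodType R) (f : U -> V) :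
    (forall a u v, f (a *: u + v) = a *: f u + f v) ->
  exists g : {linear U -> V}, g =1 f.
Proof.
move=> fL; pose lM := GRing.isLinear.Build R U V *:%R f fL.
by exists (HB.pack_for {linear U -> V} f lM).
Qed.

Section Ext.
Variables (K : closedFieldType) (Q : quiver) (n : dimvec Q).
Local Notation rep := (mrep n K).
Variable M : rep.
Local Notation X := (rep_of (M : repspace K n)).

(** [theta] defines a self-extension of [X] on pairs, with triangular arrows. Lifting [g] to it by
    projectivity, [lam] is the first component. *)
Lemma lift_extension (theta : rep) (P : qrep K Q) (g : qhom P X) : projective P ->
  exists lam : forall i, {linear qspace P i -> 'rV[K]_(n i)}, forall a p,
    lam (tgt a) (qmap P a p) = lam (src a) p *m M a + g (src a) p *m theta a.
Proof.
move=> projP.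
have exE a : exists q : {linear ('rV[K]_(n (src a)) * 'rV[K]_(n (src a)))%type ->
    ('rV[K]_(n (tgt a)) * 'rV[K]_(n (tgt a)))%type},
    q =1 (fun xy => (xy.1 *m M a + xy.2 *m theta a, xy.2 *m M a)).
  apply: linear_of => c [x y] [x' y'] /=; congr (_, _);
    rewrite /= !mulmxDl -!scalemxAl //.
  by rewrite scalerDr addrACA.
pose E := @QRep K Q (fun i => ('rV[K]_(n i) * 'rV[K]_(n i))%type : lmodType K)
  (fun a => projT1 (cid (exE a))).
have qE a xy : qmap E a xy = (xy.1 *m M a + xy.2 *m theta a, xy.2 *m M a).
  by rewrite /=; case: cid => q ->.
have exsnd i : exists q : {linear qspace E i -> qspace X i}, q =1 snd by apply: linear_of.
pose pi i := projT1 (cid (exsnd i)).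
have piE i x : pi i x = x.2 by rewrite /pi; case: cid => q ->.
have piC a (x : qspace E (src a)) : pi (tgt a) (qmap E a x) = qmap X a (pi (src a) x).
  by rewrite !piE qE.
have [i y|h hE] := projP E X (QHom piC) g; first by exists (0, y); rewrite /= piE.
have exfst i : exists q : {linear qspace P i -> 'rV[K]_(n i)}, q =1 (fun p => (h i p).1).
  by apply: linear_of => c u v; rewrite linearP.
exists (fun i => projT1 (cid (exfst i))) => a p.
have e i x : projT1 (cid (exfst i)) x = (h i x).1 by case: cid => q ->.
rewrite !e (qhom_comm h) qE /=; congr (_ + _ *m _).
by have /= := hE (src a) p; rewrite piE.
Qed.

(** The families [th j] attached to the classes [b j] span the representation space modulo the image
    of the bracket. *)
Lemma ext1_rank (c : nat) : dim_ext1_is X X c ->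
  (#|{: mentry (fun a : arr Q => n (src a)) (fun a => n (tgt a))}| <=
   \rank (bracket_mx M M) + c)%N.
Proof.
move=> [W [P [f [g [projP [fmono gepi fg] [b bP]]]]]].
have gf i w : g i (f i w) = 0 by apply/fg; exists w.
(* At each vertex the sequence is split as vector spaces; the splittings need not commute with the
   arrows. *)
have exsec i : exists s : {linear 'rV[K]_(n i) -> qspace P i}, forall v, g i (s v) = v.
  have /choice [s sP] (k : 'I_(n i)) := gepi i (delta_mx 0 k).
  have [|q qE] := @linear_of _ 'rV[K]_(n i) (qspace P i) (fun v => \sum_k v 0 k *: s k).
    move=> a u v; rewrite scaler_sumr -big_split; apply: eq_bigr => k _ /=.
    by rewrite !mxE scalerDl scalerA.
  exists q => v; rewrite qE linear_sum [RHS]row_sum_delta; apply: eq_bigr => k _.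
  by rewrite linearZ sP.
pose sec i := projT1 (cid (exsec i)).
have gsec i v : g i (sec i v) = v by rewrite /sec; case: cid.
have exret i : exists t : {linear qspace P i -> qspace W i},
    forall p, f i (t p) = p - sec i (g i p).
  have /choice [t tP] (p : qspace P i) : exists w, f i w = p - sec i (g i p).
    by apply/fg; rewrite linearB /= gsec subrr.
  have [|q qE] := @linear_of _ (qspace P i) (qspace W i) t.
    move=> a u v; apply: (fmono i); rewrite linearP /= !tP !linearP /=.
    by rewrite scalerDr addrACA.
  by exists q => p; rewrite qE.
pose ret i := projT1 (cid (exret i)).
have fret i p : f i (ret i p) = p - sec i (g i p) by rewrite /ret; case: cid.
clearbody sec ret.
have retf i w : ret i (f i w) = w by apply: (fmono i); rewrite fret gf linear0 subr0.
have split_p i p : p = f i (ret i p) + sec i (g i p) by rewrite fret subrK.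
(* The extension of [u] to [P] by [ret] fails to commute with the arrows by a map vanishing on [W].
   It factors through [g], and the factor is [theta]. *)
have theta_of (u : qhom W X) : exists theta : rep, forall a p,
    u (tgt a) (ret (tgt a) (qmap P a p)) =
    u (src a) (ret (src a) p) *m M a + g (src a) p *m theta a.
  pose F a (v : 'rV[K]_(n (src a))) : 'rV[K]_(n (tgt a)) :=
    u (tgt a) (ret (tgt a) (qmap P a (sec (src a) v))) -
    u (src a) (ret (src a) (sec (src a) v)) *m M a.
  exists (fun a => \matrix_k F a (delta_mx 0 k)) => a p.
  rewrite mul_rV_linear; last first.
    move=> x v w; rewrite /F !linearP /= mulmxDl -scalemxAl scalerBr opprD.
    by rewrite addrACA.
  rewrite /F {1 2}(split_p _ p) !linearD /= -(qhom_comm f) !retf (qhom_comm u) /=.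
  by rewrite mulmxDl -addrA [_ *m M a + (_ - _)]addrC subrK.
pose th j := projT1 (cid (theta_of (b j))).
have thE j a p : b j (tgt a) (ret (tgt a) (qmap P a p)) =
    b j (src a) (ret (src a) p) *m M a + g (src a) p *m th j a.
  by rewrite /th; case: cid.
clearbody th.
pose Th : 'M[K]_(c, _) := \matrix_j flat (th j).
suff H : (1%:M <= bracket_mx M M + Th)%MS.
  rewrite -[X in (X <= _)%N](mxrank1 K); apply: leq_trans (mxrankS H) _.
  by apply: leq_trans (mxrank_adds_leqif _ _) _; rewrite leq_add2l rank_leq_row.
apply/row_subP => k; move: (row k _) => t; rewrite -[t]unflatK.
move: (unflat t) => theta {t k}.
have [lam lamE] := lift_extension theta g projP.
(* On [W] the term with [theta] disappears because [g f = 0], so [lam] restricts to a morphism. *)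
have exu i : exists q : {linear qspace W i -> qspace X i}, q =1 (fun w => lam i (f i w)).
  by apply: linear_of => x v w; rewrite !linearP.
have uC a (w : qspace W (src a)) : projT1 (cid (exu (tgt a))) (qmap W a w) =
    qmap X a (projT1 (cid (exu (src a))) w).
  case: (cid (exu (tgt a))) => q /= ->; case: (cid (exu (src a))) => q' /= ->.
  by rewrite (qhom_comm f) lamE gf mul0mx addr0.
have [al [[h hE] _]] := bP (@QHom _ _ W X (fun i => projT1 (cid (exu i))) uC).
have {}hE i w : lam i (f i w) = \sum_(j < c) al 0 j *: b j i w + h i (f i w).
  by rewrite -hE /=; case: (cid (exu i)) => q /= ->.
(* [kap] vanishes on [W], so it is [phi] after [g]. Its failure to commute with the arrows is
   [theta] minus the combination of the [th j], which is therefore a commutator. *)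
pose kap i (p : qspace P i) : 'rV[K]_(n i) :=
  lam i p - \sum_(j < c) al 0 j *: b j i (ret i p) - h i p.
have kapL i x v w : kap i (x *: v + w) = x *: kap i v + kap i w.
  rewrite /kap [lam i _]linearP [h i _]linearP /=.
  have -> : \sum_(j < c) al 0 j *: b j i (ret i (x *: v + w)) =
     x *: (\sum_(j < c) al 0 j *: b j i (ret i v)) +
     \sum_(j < c) al 0 j *: b j i (ret i w).
    rewrite scaler_sumr -big_split; apply: eq_bigr => j _ /=.
    by rewrite [ret i _]linearP [b j i _]linearP /= scalerDr !scalerA mulrC.
  by rewrite !scalerBr !opprD [X in X + _ = _]addrACA [LHS]addrACA.
have kapf i w : kap i (f i w) = 0.
  by rewrite /kap retf hE [X in X - _ - _]addrC addrK subrr.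
pose phi : mgl n K := fun i => \matrix_k kap i (sec i (delta_mx 0 k)).
have kapE i p : kap i p = g i p *m phi i.
  rewrite /phi (mul_rV_linear (h := fun v => kap i (sec i v))); last first.
    by move=> x v w; rewrite linearP kapL.
  by rewrite [in LHS](split_p i p) -[f i _]scale1r kapL kapf scaler0 add0r.
have kapM a p : kap (tgt a) (qmap P a p) = kap (src a) p *m M a +
    g (src a) p *m (theta a - \sum_(j < c) al 0 j *: th j a).
  rewrite /kap lamE (qhom_comm h) /= !mulmxBl mulmxBr !mulmx_suml mulmx_sumr.
  rewrite (eq_bigr (fun j => (al 0 j *: b j (src a) (ret (src a) p)) *m M a +
     g (src a) p *m (al 0 j *: th j a))).
    rewrite big_split /= opprD addrACA -!addrA; congr (_ + (_ + _)).
    by rewrite addrA addrC.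
  by move=> j _; rewrite thE scalerDr scalemxAl scalemxAr.
have main a : theta a = \sum_(j < c) al 0 j *: th j a + bracket M M (fun i => - phi i) a.
  apply/row_matrixP => k; rewrite !rowE; move: (delta_mx _ _) => v.
  have := kapM a (sec (src a) v); rewrite !kapE (qhom_comm g) /= gsec => e.
  rewrite /bracket mulmxDr mulmxBr !mulNmx !mulmxN opprK !mulmxA e.
  by rewrite addKr mulmxBr addrC subrK.
have -> : flat theta = al *m Th + flat (fun i => - phi i) *m bracket_mx M M.
  rewrite mul_flat_bracket_mx mulmx_sum_row.
  apply/rowP => k; rewrite [LHS]mxE main [LHS]mxE [RHS]mxE summxE [in RHS]summxE.
  congr (_ + _); last by rewrite [RHS]mxE.
  by apply: eq_bigr => j _; rewrite rowK !mxE.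
by rewrite addrC addmx_sub_adds ?submxMl.
Qed.

End Ext.

(** * Density of the orbit *)

Lemma msizeM_leq (R : idomainType) (n : nat) (p q : {mpoly R[n]}) :
  (msize (p * q) <= msize p + msize q)%N.
Proof.
have [->|p0] := eqVneq p 0; first by rewrite mul0r msize0.
have [->|q0] := eqVneq q 0; first by rewrite mulr0 msize0.
by rewrite msizeM // leq_pred.
Qed.

Lemma msize_exp (R : idomainType) (n : nat) (p : {mpoly R[n]}) j :
  (msize (p ^+ j) <= (j * msize p).+1)%N.
Proof.
elim: j => [|j IH]; first by rewrite expr0 msize1.
rewrite exprS mulSn; apply: leq_trans (msizeM_leq _ _) _.
by rewrite -addnS leq_add2l.
Qed.

Lemma msize_prod (R : idomainType) (n : nat) (I : finType) (p : I -> {mpoly R[n]}) :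
  (msize (\prod_i p i) <= (\sum_i msize (p i)).+1)%N.
Proof.
elim/big_rec2: _ => [|i x y _ IH]; first by rewrite msize1.
by apply: leq_trans (msizeM_leq _ _) _; rewrite -addnS leq_add2l.
Qed.

(** * Dimension measured by growth of Hilbert functions *)

Section Growth.
Variables (K : closedFieldType) (N : nat).
Implicit Types (Z : set ('I_N -> K)).

Definition indep Z (T : finType) (F : T -> {mpoly K[N]}) : Prop :=
  forall c : T -> K, (forall x, Z x -> \sum_t c t * (F t).@[x] = 0) -> forall t, c t = 0.

(* The Hilbert function of [Z] grows at least like the [s]-th power. *)
Definition growth Z (s : nat) : Prop := exists D : nat, forall n : nat,
  exists (T : finType) (F : T -> {mpoly K[N]}),
  [/\ #|T| = (n ^ s)%N, forall t, (msize (F t) <= D * n.+1)%N & indep Z F].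

Lemma growth_succ Z Z' s (f : {mpoly K[N]}) :
    Z `<=` Z' -> (forall x, Z x -> f.@[x] = 0) -> ~ (forall x, Z' x -> f.@[x] = 0) ->
    (forall p q : {mpoly K[N]}, (forall x, Z' x -> p.@[x] * q.@[x] = 0) ->
       (forall x, Z' x -> p.@[x] = 0) \/ (forall x, Z' x -> q.@[x] = 0)) ->
  growth Z s -> growth Z' s.+1.
Proof.
move=> ZZ' f0 fn0 primeZ' [D growD]; exists (D + (msize f).+1)%N => n.
have [T [F [cardT sizeF indF]]] := growD n.
have fXn0 j : ~ (forall x, Z' x -> (f ^+ j).@[x] = 0).
  elim: j => [|j IH] fj.
    apply: fn0 => x /fj; rewrite expr0 meval1 => /eqP.
    by rewrite oner_eq0.
  have [x /fj|//|//] := primeZ' f (f ^+ j); by rewrite exprS mevalM.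
exists (T * 'I_n)%type, (fun tj : T * 'I_n => F tj.1 * f ^+ tj.2); split.
- by rewrite card_prod cardT card_ord expnSr.
- move=> [t j] /=; apply: leq_trans (msizeM_leq _ _) _.
  rewrite mulnDl leq_add //; apply: leq_trans (msize_exp _ _) _.
  rewrite mulSn addSn ltnS; apply: leq_trans (leq_addl _ _).
  by rewrite mulnC leq_mul // ltnW // ltnS ltnW.
move=> c c0.
suff H j : forall (jn : (j < n)%N) t, c (t, Ordinal jn) = 0.
  by case=> t [j jn]; apply: H.
elim/ltn_ind: j => j IH jn.
(* The relation divided by [f^j], the coefficients of lower powers being zero by induction. *)
pose q := \sum_(tj : T * 'I_n | (j <= tj.2)%N) c tj *: (F tj.1 * f ^+ (tj.2 - j)).
have [x Z'x|fj0|q0] := primeZ' (f ^+ j) q.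
- rewrite -mevalM /q mulr_sumr raddf_sum /= -[RHS](c0 _ Z'x).
  rewrite [RHS](bigID (fun tj : T * 'I_n => (j <= tj.2)%N)) /=.
  rewrite [X in _ + X]big1 ?addr0.
    apply: eq_bigr => -[t i] /= ji; rewrite -scalerAr mevalZ mulrCA -exprD subnKC //.
  by move=> [t [i iN]] /=; rewrite -ltnNge => ij; rewrite IH // mul0r.
- by case: (fXn0 j).
apply: indF => x Zx; have := q0 x (ZZ' _ Zx).
have -> : q.@[x] =
    \sum_t \sum_(i < n | (j <= i)%N) (c (t, i) *: (F t * f ^+ (i - j))).@[x].
  by rewrite /q raddf_sum pair_big; apply: eq_big => -[].
move=> q0x; rewrite -[RHS]q0x; apply: eq_bigr => t _.
rewrite (bigD1 (Ordinal jn)) //= subnn expr0 mulr1 mevalZ.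
rewrite big1 ?addr0 // => i /andP [ji ne].
rewrite mevalZ mevalM (_ : (i - j)%N = (i - j).-1.+1); last first.
  rewrite prednK // subn_gt0 ltn_neqAle ji andbT.
  by apply: contra_neq ne => e; apply: val_inj.
by rewrite exprS mevalM f0 // mul0r !mulr0.
Qed.

(** The family lies in the span of [(D (n + 1))^N] monomials. If [s > N], then
    [n^(N+1) <= (2 D n)^N] bounds every positive [n]. *)
Lemma growth_le Z s : growth Z s -> (s <= N)%N.
Proof.
move=> [D growD]; rewrite leqNgt; apply/negP => Ns.
suff small n : (0 < n)%N -> (n <= (D * 2) ^ N)%N.
  by have := small ((D * 2) ^ N).+1 (ltn0Sn _); rewrite ltnn.
move=> n0; have [T [F [cardT sizeF indF]]] := growD n.
suff le : (n ^ s <= (D * n.+1) ^ N)%N.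
  have nN : (n ^ N.+1 <= n ^ s)%N by rewrite leq_pexp2l.
  have := leq_trans nN le; rewrite expnS => le2.
  rewrite -(@leq_pmul2r (n ^ N)) ?expn_gt0 ?n0 //; apply: leq_trans le2 _.
  rewrite -expnMn; have [->|N0] := posnP N; first by [].
  by rewrite leq_exp2r // -mulnA leq_mul2l mul2n -addnn -addn1 leq_add2l n0 orbT.
rewrite leqNgt -cardT; apply/negP => lt.
pose b := (D * n.+1)%N; pose B := {ffun 'I_N -> 'I_b}.
pose mon (be : B) : 'X_{1..N} := [multinom (be i : nat) | i < N].
pose A : 'M[K]_(#|T|, #|B|) := \matrix_(t, be) (F (enum_val t))@_(mon (enum_val be)).
have : kermx A != 0.
  rewrite kermx_eq0 /row_free neq_ltn; apply/orP; left.
  by apply: leq_ltn_trans (rank_leq_col _) _; rewrite card_ffun !card_ord.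
case/rowV0Pn => u /sub_kermxP uA; apply/negP; rewrite negbK; apply/eqP/rowP => k.
rewrite mxE; pose c t := u 0 (enum_rank t).
have -> : u 0 k = c (enum_val k) by rewrite /c enum_valK.
apply: indF => x _; have F0 : \sum_t c t *: F t = 0.
  apply/mpolyP => m; rewrite mcoeff0 raddf_sum /=.
  have [mb|] := boolP [forall i, (m i < b)%N].
    pose be : B := [ffun i => Ordinal (fintype.forallP mb i)].
    have mE : m = mon be by apply/mnmP => i; rewrite mnmE ffunE.
    have /rowP /(_ (enum_rank be)) := uA; rewrite !mxE => uAx; rewrite -[RHS]uAx.
    rewrite [RHS](reindex_onto enum_rank enum_val) => [|i _]; last exact: enum_valK.
    apply: eq_big => [t|t _]; first by rewrite enum_rankK eqxx.
    by rewrite mcoeffZ mxE !enum_rankK -mE.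
  rewrite negb_forall => /fintype.existsP [i]; rewrite -leqNgt => bi.
  rewrite big1 // => t _; rewrite mcoeffZ memN_msupp_eq0 ?mulr0 //.
  apply: msize_mdeg_ge; apply: leq_trans (sizeF t) _; apply: leq_trans bi _.
  by rewrite mdegE (bigD1 i) //= leq_addr.
rewrite -[RHS](meval0 x) -F0 raddf_sum; apply: eq_bigr => t _.
by rewrite /= mevalZ.
Qed.

End Growth.

(* Along the curve [t w(t) / delta(t)] with tangent [a] at the origin, [P] starts
   with [t^m] times the value at [a] of its lowest homogeneous part. *)
Lemma vanish_on_curves (K : closedFieldType) (r : nat) (P : {mpoly K[r]}) :
    (forall a : 'I_r -> K, exists (w : 'I_r -> {poly K}) (delta : {poly K}),
      [/\ forall i, (w i).[0] = a i, delta.[0] = 1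
        & forall t, delta.[t] != 0 -> P.@[fun i => t * (w i).[t] / delta.[t]] = 0]) ->
  P = 0.
Proof.
move=> curves; apply/eqP; apply: contraT => P0.
have exm : exists k, has (fun al => mdeg al == k) (msupp P).
  have : msupp P != [::] by rewrite msupp_eq0.
  by case: (msupp P) => // al s _; exists (mdeg al); rewrite /= eqxx.
case: (ex_minnP exm) => m /hasP [al0 al0P /eqP al0m] mmin.
have mle al : al \in msupp P -> (m <= mdeg al)%N.
  by move=> alP; apply: mmin; apply/hasP; exists al.
pose L : {mpoly K[r]} := \sum_(al <- msupp P | mdeg al == m) P@_al *: 'X_[al].
have L0 : L <> 0.
  move/(congr1 (mcoeff al0)); rewrite mcoeff0 raddf_sum /= -big_filter.
  rewrite (bigD1_seq al0) ?filter_uniq ?msupp_uniq ?mem_filter ?al0m ?eqxx //=.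
  rewrite mcoeffZ mcoeffX eqxx mulr1 big1 ?addr0 => [|al ne].
    by apply/eqP; rewrite -mcoeff_msupp.
  by rewrite mcoeffZ mcoeffX (negbTE ne) mulr0.
have [a La] : exists a, L.@[a] <> 0.
  apply: contrapT => nex; apply: L0; apply: meval_eq0 => a; apply: contrapT => La.
  by apply: nex; exists a.
have [w [delta [w0 delta0 van]]] := curves a.
(* [P] along the curve, cleared of denominators by [delta^(msize P)] and divided by [t^m]; its value
   at 0 is [L] at [a]. *)
pose Qp : {poly K} := \sum_(al <- msupp P)
  P@_al *: ('X ^+ (mdeg al - m) * \prod_i (w i) ^+ (al i) * delta ^+ (msize P - mdeg al)).
have field_id (x y z p u D : K) :
    D != 0 -> x * (p * (y * z * u)) = u * D * (p * (x * y * z / D)).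
  by move=> D0; field.
(* The factors ['X] and [delta] cover the points where the curve gives no information. *)
have QE t : (Qp * 'X * delta).[t] = 0.
  rewrite !hornerM hornerX; have [->|t0] := eqVneq t 0; first by rewrite mulr0 mul0r.
  have [->|d0] := eqVneq delta.[t] 0; first by rewrite mulr0.
  suff -> : Qp.[t] = 0 by rewrite !mul0r.
  apply: (mulfI (expf_neq0 m t0)).
  rewrite mulr0 -[RHS](mulr0 (delta.[t] ^+ msize P)) -(van t d0) mevalE.
  rewrite /Qp horner_sum !mulr_sumr big_seq [RHS]big_seq; apply: eq_bigr => al alP.
  rewrite hornerZ !hornerM !horner_exp hornerX horner_prod.
  have -> : \prod_i (t * (w i).[t] / delta.[t]) ^+ al i =
     t ^+ mdeg al * \prod_i (w i ^+ al i).[t] / delta.[t] ^+ mdeg al.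
    under eq_bigr do rewrite !exprMn exprVn.
    rewrite !big_split /= prodfV mdegE -!prodrXr; congr (_ * _ / _).
    by apply: eq_bigr => i _; rewrite horner_exp.
  have -> : t ^+ mdeg al = t ^+ m * t ^+ (mdeg al - m) by rewrite -exprD subnKC ?mle.
  have -> : delta.[t] ^+ msize P =
      delta.[t] ^+ (msize P - mdeg al) * delta.[t] ^+ mdeg al.
    by rewrite -exprD subnK // ltnW // msize_mdeg_lt.
  exact/field_id/expf_neq0.
have Q0 : Qp = 0.
  have : Qp * 'X * delta = 0.
    by apply/eqP; apply: contraT => /closed_nonrootP [x]; rewrite /root QE eqxx.
  move/eqP; rewrite !mulf_eq0 polyX_eq0 orbF => /orP [/eqP //|/eqP d0].
  by move: delta0; rewrite d0 horner0 => /esym/eqP; rewrite oner_eq0.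
case: La; rewrite -[RHS](horner0 0) -Q0 /Qp /L raddf_sum /= horner_sum big_mkcond big_seq.
rewrite [RHS]big_seq; apply: eq_bigr => al alP.
rewrite hornerZ !hornerM !horner_exp hornerX delta0 expr1n mulr1 horner_prod.
rewrite mevalZ mevalX.
have [e|ne] := eqVneq (mdeg al) m.
  rewrite e subnn expr0 mul1r; congr (_ * _); apply: eq_bigr => i _.
  by rewrite horner_exp w0.
rewrite expr0n subn_eq0 leqNgt ltn_neqAle eq_sym ne mle //= mul0r mulr0.
by [].
Qed.

(** * Independent functions on the orbit *)

Section Orbit.
Variables (K : closedFieldType) (Q : quiver) (n : dimvec Q).
Local Notation rep := (mrep n K).
Local Notation gl := (mgl n).
Local Notation dR := #|{: mentry (fun a : arr Q => n (src a)) (fun a => n (tgt a))}|.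
Variable M : repspace K n.
Local Notation r := (\rank (bracket_mx M M)).

Definition conjugates : set rep := [set N | exists g g' : gl K,
  [/\ forall i, g i *m g' i = 1%:M, forall i, g' i *m g i = 1%:M
    & forall a, N a = g (src a) *m M a *m g' (tgt a)]].

(** The curve conjugates [M] by [1 + t phi], whose inverse is [H / delta]; its tangent at 0 is the
    commutator with [phi]. *)
Lemma orbit_curve (phi : gl K) : exists (H : gl {poly K}) (delta : {poly K}),
  [/\ forall i, map_mx (horner_eval 0) (H i) = 1%:M, delta.[0] = 1
    & forall t, delta.[t] != 0 -> conjugates (fun a => M a +
        (t / delta.[t]) *: (bracket M M phi a *m map_mx (horner_eval t) (H (tgt a))))].
Proof.
pose gp : gl {poly K} := fun i => 1%:M + 'X *: map_mx polyC (phi i).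
have gpE t i : map_mx (horner_eval t) (gp i) = 1%:M + t *: phi i.
  apply/matrixP => p q; rewrite !mxE /= /horner_eval hornerD hornerM hornerX hornerC.
  by rewrite hornerMn hornerC.
have [H [gpH Hgp]] := gl_adjugate gp; set delta := \prod_j _ in gpH Hgp.
have delta0 : delta.[0] = 1.
  rewrite /delta horner_prod big1 // => i _.
  by rewrite -[LHS]/(horner_eval 0 _) -det_map_mx gpE scale0r addr0 det1.
have ev t i : map_mx (horner_eval t) (gp i) *m map_mx (horner_eval t) (H i) =
    delta.[t]%:M.
  by rewrite -map_mxM gpH map_scalar_mx.
have ev' t i : map_mx (horner_eval t) (H i) *m map_mx (horner_eval t) (gp i) =
    delta.[t]%:M.
  by rewrite -map_mxM Hgp map_scalar_mx.
exists H, delta; split=> // [i|t d0].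
  by have := ev 0 i; rewrite gpE scale0r addr0 mul1mx delta0.
exists (fun i => map_mx (horner_eval t) (gp i)).
exists (fun i => delta.[t]^-1 *: map_mx (horner_eval t) (H i)); split=> [i|i|a].
- by rewrite -scalemxAr ev scale_scalar_mx mulVf.
- by rewrite -scalemxAl ev' scale_scalar_mx mulVf.
have e : map_mx (horner_eval t) (gp (src a)) *m M a =
    M a *m map_mx (horner_eval t) (gp (tgt a)) + t *: bracket M M phi a.
  rewrite !gpE mulmxDl mulmxDr mul1mx mulmx1 /bracket -scalemxAl -scalemxAr.
  by rewrite scalerBr -addrA; congr (_ + _); rewrite addrC subrK.
rewrite e mulmxDl -mulmxA -scalemxAr ev scale_scalar_mx mulVf // mulmx1.
by congr (_ + _); rewrite -scalemxAl -scalemxAr scalerA.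
Qed.

(** The monomials in [r] affine forms vanishing at [M] are independent on the orbit, because tangent
    vectors to the curves above take arbitrary values on their linear parts. *)
Lemma orbit_growth : growth [set x | exists2 N, conjugates N & x = flat N 0] r.
Proof.
have [C1 [D1 CAD]] := rank_two_sided_inverse (bracket_mx M M).
pose l (i : 'I_r) : {mpoly K[dR]} := \sum_k D1 k i *: ('X_k - (flat M 0 k)%:MP).
have lE i x : (l i).@[x] = \sum_k (x k - flat M 0 k) * D1 k i.
  rewrite raddf_sum; apply: eq_bigr => k _ /=.
  by rewrite mevalZ mevalB mevalXU mevalC mulrC.
pose e := (\sum_i msize (l i))%N; exists (r * e.+1).+1 => m.
pose F (t : {ffun 'I_r -> 'I_m}) := \prod_i l i ^+ t i.
exists {ffun 'I_r -> 'I_m}, F; split.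
- by rewrite card_ffun !card_ord.
- move=> t; apply: leq_trans (msize_prod _) _; rewrite mulSn addSn ltnS.
  apply: leq_trans (leq_addl _ _); rewrite -mulnA.
  rewrite -[X in (X * _)%N]card_ord -sum_nat_const.
  apply: leq_sum => i _; apply: leq_trans (msize_exp _ _) _.
  rewrite mulSn addSn ltnS; apply: leq_trans (leq_addl _ _); rewrite mulnC.
  apply: leq_mul; first by rewrite /e (bigD1 i) //= leq_addr.
  by rewrite ltnW // ltnS ltnW.
move=> c c0; pose mon (t : {ffun 'I_r -> 'I_m}) := [multinom (t i : nat) | i < r].
have mon_inj : injective mon.
  move=> t1 t2 /mnmP mt; apply/ffunP => i; apply: val_inj.
  by have := mt i; rewrite !mnmE.
pose P : {mpoly K[r]} := \sum_t c t *: 'X_[mon t].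
have PE x : P.@[fun i => (l i).@[x]] = \sum_t c t * (F t).@[x].
  rewrite raddf_sum; apply: eq_bigr => t _ /=; rewrite mevalZ mevalX /F.
  rewrite rmorph_prod /=; congr (_ * _); apply: eq_bigr => i _.
  by rewrite rmorphXn mnmE.
suff P0 : P = 0.
  move=> t; have := congr1 (mcoeff (mon t)) P0; rewrite mcoeff0 raddf_sum /=.
  rewrite (bigD1 t) //= mcoeffZ mcoeffX eqxx mulr1 big1 ?addr0 // => t' ne.
  by rewrite mcoeffZ mcoeffX (inj_eq mon_inj) (negbTE ne) mulr0.
apply: vanish_on_curves => a.
(* Since [C1 A D1 = 1] for [A = bracket_mx M M], the commutator of this [phi] has coordinates [a]
   under [D1]. *)
pose phi : gl K := unflat (\row_i a i *m C1).
have [H [delta [H0 delta0 orbH]]] := orbit_curve phi.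
pose W : 'rV[{poly K}]_r :=
  flat (fun b => map_mx polyC (bracket M M phi b) *m H (tgt b)) *m map_mx polyC D1.
have WE t : map_mx (horner_eval t) W =
    flat (fun b => bracket M M phi b *m map_mx (horner_eval t) (H (tgt b))) *m D1.
  have hC p q (X : 'M[K]_(p, q)) : map_mx (horner_eval t) (map_mx polyC X) = X.
    by apply/matrixP => i j; rewrite !mxE /= /horner_eval hornerC.
  rewrite map_mxM hC map_flat; congr (flat _ *m _).
  by apply: functional_extensionality_dep => b; rewrite /map_fam map_mxM hC.
exists (W 0), delta; split=> // [i|t d0].
  have := congr1 (fun X : 'rV_r => X 0 i) (WE 0); rewrite mxE /horner_eval => ->.
  rewrite (_ : (fun b => _) = bracket M M phi); last first.
    by apply: functional_extensionality_dep => b; rewrite H0 mulmx1.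
  by rewrite -mul_flat_bracket_mx unflatK -!mulmxA [C1 *m _]mulmxA CAD mulmx1 mxE.
pose N : rep := fun b => M b + (t / delta.[t]) *:
  (bracket M M phi b *m map_mx (horner_eval t) (H (tgt b))).
rewrite -[RHS](c0 (flat N 0)); last by exists N => //; apply: orbH.
rewrite -PE; apply: meval_eq => i; rewrite lE mulrAC.
have /rowP/(_ i) := WE t; rewrite mxE /horner_eval => ->.
rewrite [X in _ * X]mxE mulr_sumr.
apply: eq_bigr => k _; rewrite mulrA; congr (_ * _).
by rewrite !mxE addrAC subrr add0r.
Qed.

End Orbit.

Section Density.
Variables (K : closedFieldType) (Q : quiver) (e : dimvec Q).
Local Notation rep := (repspace K e).
Implicit Types Z : set rep.

Definition points_of Z : set ('I_#|{: entry e}| -> K) :=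
  [set x | exists2 N, Z N & x = flat (N : mrep e K) 0].

Lemma meval_coords (p : {mpoly K[#|{: entry e}|]}) (N : rep) :
  p.@[coords N] = p.@[flat (N : mrep e K) 0].
Proof. by apply: meval_eq => k; rewrite [RHS]mxE. Qed.

Lemma irreducible_prime Z : irreducible_closed Z ->
  forall p q : {mpoly K[#|{: entry e}|]},
    (forall x, points_of Z x -> p.@[x] * q.@[x] = 0) ->
  (forall x, points_of Z x -> p.@[x] = 0) \/ (forall x, points_of Z x -> q.@[x] = 0).
Proof.
move=> [_ _ irrZ] p q pq0.
pose zeros (f : {mpoly K[#|{: entry e}|]}) : set rep := [set N | f.@[coords N] = 0].
have zerosC f : zariski_closed (zeros f).
  exists [set f]; apply/seteqP; split=> [N fN g -> //|N fN].
  exact: fN.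
have [N ZN|Zp|Zq] := irrZ _ _ (zerosC p) (zerosC q).
- have /eqP := pq0 (flat (N : mrep e K) 0) (ex_intro2 _ _ N ZN erefl).
  by rewrite mulf_eq0 -!meval_coords => /orP [] /eqP; [left|right].
- by left=> x [N /Zp ZN ->]; rewrite -meval_coords.
- by right=> x [N /Zq ZN ->]; rewrite -meval_coords.
Qed.

(** At each strict inclusion some equation of the smaller set does not vanish on the larger one, so
    the growth exponent rises by one. *)
Lemma chain_growth Z c s : closed_chain Z c -> growth (points_of Z) s ->
  (s + c <= #|{: entry e}|)%N.
Proof.
move=> [F [F0 irrF ltF]] growZ.
suff H k (kc : (k < c.+1)%N) : growth (points_of (F (Ordinal kc))) (s + k).
  exact: growth_le (H c (ltnSn c)).
elim: k kc => [|k IH] kc.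
  by rewrite addn0 (_ : Ordinal kc = ord0) ?F0 //; apply: val_inj.
have kc' := ltnW kc; have [sub nsub] := ltF (Ordinal kc') (Ordinal kc) erefl.
have [[I FI] _ _] := irrF (Ordinal kc').
have [f [If fN]] : exists f, I f /\
    ~ (forall x, points_of (F (Ordinal kc)) x -> f.@[x] = 0).
  apply: contrapT => nex; apply: nsub => N FN; rewrite FI => f If.
  apply: contrapT => fN; apply: nex; exists f; split=> // all0; apply: fN.
  by rewrite meval_coords; apply: all0; exists N.
rewrite addnS; apply: (growth_succ _ _ fN (irreducible_prime (irrF _)) (IH kc')).
  by move=> x [N /sub FN ->]; exists N.
by move=> x [N + ->]; rewrite FI -meval_coords; apply.
Qed.

(** A polynomial vanishing on [Z] but not on [Z'] would give [Z'] exponent [s + 1], too large in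
    view of the chain above it. *)
Lemma dense_of_growth Z Z' c s : irreducible_closed Z' -> Z `<=` Z' ->
    closed_chain Z' c -> growth (points_of Z) s -> (#|{: entry e}| <= s + c)%N ->
  forall p : {mpoly K[#|{: entry e}|]},
    (forall x, points_of Z x -> p.@[x] = 0) -> forall x, points_of Z' x -> p.@[x] = 0.
Proof.
move=> irrZ' ZZ' chainZ' growZ le p p0; apply: contrapT => pn0.
have : growth (points_of Z') s.+1.
  apply: (growth_succ _ p0 pn0 (irreducible_prime irrZ') growZ).
  by move=> x [N /ZZ' ZN ->]; exists N.
move=> /(chain_growth chainZ') le'; have := leq_trans le' le.
by rewrite addSn ltnn.
Qed.

End Density.

(** * The rank bound on [A_d] *)

Section RankBound.
Variables (K : closedFieldType) (Q : quiver) (nu : nat) (d : filtration Q nu).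
Local Notation n := (d ord_max).
Local Notation rep := (mrep n).
Local Notation gl := (mgl n).
Variable M : repspace K n.
Local Notation r := (\rank (bracket_mx M M)).

Lemma orbit_avar : Avar K d M -> @conjugates K Q n M `<=` Avar K d.
Proof.
move=> [R [[U HU] _]] N [g [g' [gg' g'g NE]]].
have [E [flagE _]] := idflag_of_flag HU.
pose rho : {rmorphism K -> R} := in_alg R.
have inv (h h' : gl K) : (forall i, h i *m h' i = 1%:M) ->
    forall i, map_fam rho h i *m map_fam rho h' i = 1%:M.
  by move=> hh' i; rewrite /map_fam -map_mxM hh' map_mx1.
have Mg a : map_fam rho M a *m map_fam rho g' (tgt a) =
    map_fam rho g' (src a) *m map_fam rho N a.
  by rewrite /map_fam -!map_mxM NE !mulmxA g'g mul1mx.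
have flagN := conj_idflag (inv _ _ g'g) (inv _ _ gg') Mg flagE.
by exists R, (exist _ _ (flag_of_idflag flagN)).
Qed.

Lemma std_avar (Y : repspace K n) : std Y -> Avar K d Y.
Proof.
move=> /std_idflag flagY.
have {}flagY : @idflag Q nu d K^o (map_fam (in_alg K^o) Y) (stdchain d K^o).
  rewrite (_ : map_fam _ Y = Y) //.
  apply: functional_extensionality_dep => a; apply/matrixP => i j.
  by rewrite mxE /= [LHS]mulr1.
by exists K^o, (exist _ _ (flag_of_idflag flagY)).
Qed.

Lemma orbit_rank (N : rep K) : @conjugates K Q n M N -> (\rank (bracket_mx M N) <= r)%N.
Proof.
move=> [g [g' [gg' g'g NE]]].
have Mg a : M a *m g' (tgt a) = 1 *: (g' (src a) *m N a).
  by rewrite scale1r NE !mulmxA g'g mul1mx.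
have [LG [LH]] := bracket_conj M Mg gg'.
rewrite mulr1 scale1r (_ : (fun a => 1 *: M a) = M); last first.
  by apply: functional_extensionality_dep => a; rewrite scale1r.
move=> <-; apply: leq_trans (mxrankM_maxl _ _) _; exact: mxrankM_maxr.
Qed.

(** A larger rank at [N] yields a minor of size [r + 1] that is nonzero there. As a polynomial in
    the representation it vanishes on the orbit of [M], hence by density on [A_d]. *)
Lemma avar_rank c : Avar K d M -> closed_chain (Avar K d) c ->
    (#|{: entry n}| <= r + c)%N ->
  forall N : rep K, Avar K d N -> (\rank (bracket_mx M N) <= r)%N.
Proof.
move=> AM chainA le N AN; rewrite leqNgt; apply/negP => rN.
have [C0 [D0 CND0]] := rank_two_sided_inverse (bracket_mx M N).
(* Only the first [r + 1] rows and columns of the normalized minor are kept. *)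
have [C1 [D1 CND]] : exists (C1 : 'M[K]_(r.+1, _)) (D1 : 'M[K]_(_, r.+1)),
    C1 *m bracket_mx M N *m D1 = 1%:M.
  exists (pid_mx r.+1 *m C0), (D0 *m pid_mx r.+1).
  rewrite !mulmxA -[pid_mx r.+1 *m _ *m _]mulmxA -[pid_mx r.+1 *m _ *m D0]mulmxA CND0.
  by rewrite mulmx1 mul_pid_mx !minnn (minn_idPr rN) pid_mx_1.
pose R := {mpoly K[#|{: entry n}|]}; pose rho : {rmorphism K -> R} := @mpolyC _ K.
pose X : mrep n R := unflat (\row_k 'X_k).
pose p : R := \det (map_mx rho C1 *m bracket_mx (map_fam rho M) X *m map_mx rho D1).
have pE (Y : rep K) : p.@[flat Y 0] = \det (C1 *m bracket_mx M Y *m D1).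
  have rhoK m1 m2 (Z : 'M[K]_(m1, m2)) : map_mx (meval (flat Y 0)) (map_mx rho Z) = Z.
    by apply/matrixP => i j; rewrite !mxE mevalC.
  rewrite -[LHS]/(meval (flat Y 0) p) -det_map_mx !map_mxM !rhoK map_bracket_mx.
  have -> : map_fam (meval (flat Y 0)) (map_fam rho M) = M.
    by apply: functional_extensionality_dep => a; exact: rhoK.
  suff -> : map_fam (meval (flat Y 0)) X = Y by [].
  rewrite map_unflat -[RHS]flatK; congr unflat.
  by apply/rowP => k; rewrite mxE [X in _ X = _]mxE mevalXU.
have irrA : irreducible_closed (Avar K d).
  by have [F [F0 irrF _]] := chainA; rewrite -F0.
have pA := dense_of_growth irrA (orbit_avar AM) chainA (orbit_growth M) le (p := p).
have : p.@[flat N 0] = 0.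
  apply: pA; last by exists N.
  by move=> x [Y OY ->]; rewrite pE; apply/det_low_rank/orbit_rank.
by rewrite pE CND det1 => /eqP; rewrite oner_eq0.
Qed.

End RankBound.

Unset Implicit Arguments.

Theorem theorem3 (K : closedFieldType) (Q : quiver) (nu : nat)
    (d : filtration Q nu) (M : repspace K (d ord_max)) :
  Avar K d M ->
  (exists c : nat, dim_ext1_is (rep_of M) (rep_of M) c /\ codim_is (Avar K d) c) ->
  smooth (Fl M) /\ irreducible (Fl M).
Proof.
move=> AM [c [/(@ext1_rank _ _ (d ord_max)) extM [chainA _]]].
have rank_std Y : std Y -> (\rank (bracket_mx M Y) <= \rank (bracket_mx M M))%N.
  by move=> /std_avar; apply: avar_rank chainA extM _.
by split; [exact: smooth_Fl|exact: irreducible_Fl].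
Qed.
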